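(* Let $d \geq 1$, let $(B(x_j,r_j))_{j=1}^\infty$ be a sequence of balls in $\mathbb{T}^d$ with $r_j \to 0$, and let $(U_j)_{j=1}^\infty$ be a sequence of (nonempty) open sets such that $U_j \subset B(x_j,r_j)$ for all $j$. Let \[ s = \sup \Bigl\{\, t \in (0,d) : \sup_{j} \frac{I_t(U_j)\, \lambda(B(x_j,r_j))}{\lambda(U_j)^2} < \infty \,\Bigr\}. \] Suppose that the set $E = \limsup_{j\to\infty} B(x_j,r_j)$ has full Lebesgue measure, i.e. $\lambda(\mathbb{T}^d \setminus E) = 0$. Then the set $E_U = \limsup_{j \to \infty} U_j$ satisfies $\dim_{\mathrm{H}} E_U \geq s$ and $E_U \in \mathscr{G}^s(\mathbb{T}^d)$.
   Context: $\mathbb{T}^d = \mathbb{R}^d/\mathbb{Z}^d$ is the $d$-dimensional torus with the distance $|x-y|$ induced by the Euclidean distance, $\pi\colon \mathbb{R}^d \to \mathbb{T}^d$ is the projection $\pi(x) = x \bmod 1$, $\lambda$ is Lebesgue measure on $\mathbb{T}^d$, and $B(x,r)$ is the (open) ball with centre $x$ and radius $r>0$. For sets $A_j$, $\limsup_{j\to\infty} A_j = \bigcap_{k=1}^\infty \bigcup_{j=k}^\infty A_j$. $\dim_{\mathrm{H}}$ denotes Hausdorff dimension. For $0<t<d$, the $t$-dimensional Riesz energy of a set $U \subset \mathbb{T}^d$ is $I_t(U) = \int_U \int_U |x-y|^{-t}\, \mathrm{d}x\, \mathrm{d}y$ (integration with respect to $\lambda$). The supremum of the empty set of $t$ is taken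 to be $0$. Classes of sets with large intersections: a dyadic cube in $\mathbb{R}^d$ is a set $\prod_{i=1}^d [k_i 2^{-n}, (k_i+1)2^{-n})$ with $k_1,\dots,k_d,n$ integers, and $|D|$ is the diameter of $D$. For $E \subset \mathbb{R}^d$ let $\mathscr{M}^t_\infty(E) = \inf\{\sum_k |D_k|^t : E \subset \bigcup_k D_k,\ D_k \text{ dyadic cubes}\}$ (countable covers). $\mathscr{G}^s$ is the family of $G_\delta$-sets $E \subset \mathbb{R}^d$ such that $\mathscr{M}^t_\infty(E \cap D) \geq |D|^t$ for all dyadic cubes $D$ and all $0<t<s$. $\mathscr{G}^s(\mathbb{T}^d)$ is the family of sets $E \subset \mathbb{T}^d$ with $\pi^{-1}(E) \in \mathscr{G}^s$. *)

(* Defs.v *)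
From HB Require Import structures.
From mathcomp Require Import all_boot all_order all_algebra.
From mathcomp Require Import all_classical all_reals all_analysis borel_hierarchy.

Set Implicit Arguments.
Unset Strict Implicit.
Unset Printing Implicit Defensive.

Import Order.TTheory GRing.Theory Num.Theory.
Import numFieldNormedType.Exports.

Local Open Scope classical_set_scope.
Local Open Scope ring_scope.
Local Open Scope quotient_scope.

(* The library's norm on 'rV[R]_d is the sup norm; its topology on 'rV[R]_d is
   the usual one. *)
Definition euclid_norm {R : realType} {d : nat} (x : 'rV[R]_d) : R :=
  Num.sqrt (\sum_(i < d) x ord0 i ^+ 2).

Definition euclid_dist {R : realType} {d : nat} (x y : 'rV[R]_d) : R := euclid_norm (x - y).

Definition row_display : measure_display.
Proof. exact: default_measure_display. Qed.

Section measurable_row.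
Context {R : realType} {d : nat}.

Let coord (i : 'I_d) (x : 'rV[R]_d) : measurableTypeR R := x ord0 i.

Let row_set0 : g_sigma_preimage coord set0.
Proof. exact: sigma_algebra0. Qed.

Let row_setC A : g_sigma_preimage coord A -> g_sigma_preimage coord (~` A).
Proof. exact: sigma_algebraC. Qed.

Let row_bigcup (F : _^nat) : (forall i, g_sigma_preimage coord (F i)) ->
  g_sigma_preimage coord (\bigcup_i (F i)).
Proof. exact: sigma_algebra_bigcup. Qed.

HB.instance Definition _ := @isMeasurable.Build row_display
  'rV[R]_d (g_sigma_preimage coord) row_set0 row_setC row_bigcup.

Lemma measurable_row_coord (i : 'I_d) :
  measurable_fun [set: 'rV[R]_d] (fun x => x ord0 i : measurableTypeR R).
Proof.
move=> _ Y mY; rewrite setTI; apply: sub_sigma_algebra => /=.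
rewrite -bigcup_seq/=; exists i => /=; first by rewrite mem_index_enum.
by exists Y => //; rewrite setTI.
Qed.

Definition row_of_tuple (t : d.-tuple (measurableTypeR R)) : 'rV[R]_d :=
  \row_i tnth t i.

Lemma measurable_row_of_tuple : measurable_fun setT row_of_tuple.
Proof.
move=> _ A mA; rewrite setTI.
suff -> : measurable = preimage_set_system setT row_of_tuple
   (g_sigma_preimage coord) by exists A => //; rewrite setTI.
rewrite -g_sigma_preimage_comp; congr (g_sigma_preimage _).
by apply/funext => i; apply/funext => t; rewrite /= /coord mxE.
Qed.

End measurable_row.

Lemma pushforward_semi_sigma_additive d1 d2 (T1 : measurableType d1)
    (T2 : measurableType d2) (R : realFieldType)
    (m : {measure set T1 -> \bar R}) (f : T1 -> T2) :
  measurable_fun setT f -> semi_sigma_additive (pushforward m f).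
Proof. by move=> mf; exact: measure_semi_sigma_additive. Qed.

Lemma sigma_finite_product d1 d2 (T1 : measurableType d1)
    (T2 : measurableType d2) (R : realType)
    (m1 : {sigma_finite_measure set T1 -> \bar R})
    (m2 : {sigma_finite_measure set T2 -> \bar R}) :
  sigma_finite setT (m1 \x m2)%E.
Proof.
have /sigma_finiteP[F [FT ndF Foo]] := sigma_finiteT m1.
have /sigma_finiteP[G [GT ndG Goo]] := sigma_finiteT m2.
exists (fun n => F n `*` G n).
  rewrite -setXTT FT GT predeqE => -[x y]; split => [[/= [n _ Fx] [k _ Gy]]|].
    exists (maxn n k) => //; split.
      by move: x Fx; exact/subsetPset/ndF/leq_maxl.
    by move: y Gy; exact/subsetPset/ndG/leq_maxr.
  by move=> [n _ []/= ? ?]; split; exists n.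
move=> k; have [? ?] := Foo k; have [? ?] := Goo k.
split; first exact: measurableX.
by rewrite product_measure1E// lte_mul_pinfty// ge0_fin_numE.
Qed.

(* Lebesgue measure on R^n as the n-fold product of [lebesgue_measure]; it is
   built on tuples and then transported to row vectors. *)
Section lebesgue_tuple.
Context {R : realType}.
Local Notation RM := (measurableTypeR R).

Definition tuple_cons {n : nat} (p : RM * n.-tuple RM) : n.+1.-tuple RM :=
  [tuple of p.1 :: p.2].

Lemma measurable_tuple_cons n : measurable_fun setT (@tuple_cons n).
Proof.
exact: (measurable_cons measurable_fst measurable_snd).
Qed.

Section step.
Context {n : nat} (m : {sigma_finite_measure set (n.-tuple RM) -> \bar R}).

Definition tuple_step : set (n.+1.-tuple RM) -> \bar R :=
  pushforward (lebesgue_measure \x m)%E tuple_cons.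

Let tuple_step0 : tuple_step set0 = 0%E.
Proof. by rewrite /tuple_step /pushforward preimage_set0 measure0. Qed.

Let tuple_step_ge0 A : (0 <= tuple_step A)%E.
Proof. exact: (measure_ge0 (lebesgue_measure \x m)%E). Qed.

Let tuple_step_additive : semi_sigma_additive tuple_step.
Proof.
exact: (pushforward_semi_sigma_additive (m := (lebesgue_measure \x m)%E)
  (@measurable_tuple_cons n)).
Qed.

HB.instance Definition _ := isMeasure.Build _ _ _ tuple_step
  tuple_step0 tuple_step_ge0 tuple_step_additive.

Let tuple_step_sigma_finite : sigma_finite setT tuple_step.
Proof.
have [F FT mF] := sigma_finite_product lebesgue_measure m.
pose g (t : n.+1.-tuple RM) : RM * n.-tuple RM := (thead t, [tuple of behead t]).
have gK : cancel tuple_cons g by move=> [x t]; congr pair; apply/val_inj.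
have Kg : cancel g tuple_cons by move=> t; rewrite [RHS]tuple_eta; apply/val_inj.
have mg : measurable_fun setT g.
  apply/measurable_fun_pairP; split; first exact: measurable_tnth.
  exact: measurable_behead.
exists (fun i => g @^-1` F i).
  by rewrite -preimage_bigcup -FT preimage_setT.
move=> i; split; first by rewrite -[X in measurable X]setTI; apply: mg => //; case: (mF i).
rewrite /tuple_step /pushforward -comp_preimage.
by rewrite (_ : g \o _ = id) ?preimage_id; [case: (mF i)|apply/funext].
Qed.

HB.instance Definition _ := Measure_isSigmaFinite.Build _ _ _ tuple_step
  tuple_step_sigma_finite.
End step.

Fixpoint lebesgue_tuple (n : nat) :
    {sigma_finite_measure set (n.-tuple RM) -> \bar R} :=
  if n is n'.+1 then tuple_step (lebesgue_tuple n') else \d_([tuple] : 0.-tuple RM).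
End lebesgue_tuple.

Section lebesgue_row.
Context {R : realType} {d : nat}.

Definition lebesgue_row : set 'rV[R]_d -> \bar R :=
  pushforward (@lebesgue_tuple R d) row_of_tuple.

Let lebesgue_row0 : lebesgue_row set0 = 0%E.
Proof. by rewrite /lebesgue_row /pushforward preimage_set0 measure0. Qed.

Let lebesgue_row_ge0 A : (0 <= lebesgue_row A)%E.
Proof. exact: (measure_ge0 (@lebesgue_tuple R d)). Qed.

Let lebesgue_row_additive : semi_sigma_additive lebesgue_row.
Proof.
exact: (pushforward_semi_sigma_additive (m := @lebesgue_tuple R d)
  measurable_row_of_tuple).
Qed.

HB.instance Definition _ := isMeasure.Build _ _ _ lebesgue_row
  lebesgue_row0 lebesgue_row_ge0 lebesgue_row_additive.
End lebesgue_row.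

Section torus.
Variables (R : realType) (d : nat).

Definition torus_rel (x y : 'rV[R]_d) : bool :=
  `[< exists k : 'rV[int]_d, x - y = map_mx intr k >].

Let torus_rel_refl : reflexive torus_rel.
Proof. by move=> x; apply/asboolP; exists 0; rewrite subrr map_mx0. Qed.

Let torus_rel_sym : symmetric torus_rel.
Proof.
move=> x y; apply/asboolP/asboolP => -[k xyk]; exists (- k);
  by rewrite map_mxN -xyk opprB.
Qed.

Let torus_rel_trans : transitive torus_rel.
Proof.
move=> y x z /asboolP[k xyk] /asboolP[l yzl]; apply/asboolP; exists (k + l).
by rewrite map_mxD -xyk -yzl addrA subrK.
Qed.

Definition torus_equiv : equiv_rel 'rV[R]_d :=
  EquivRel torus_rel torus_rel_refl torus_rel_sym torus_rel_trans.

(* R^d / Z^d with the quotient topology, which is also the topology of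
   [torus_dist] below. *)
Definition torus : Type := quotient_topology {eq_quot torus_equiv}.

HB.instance Definition _ := PointedTopological.on torus.
HB.instance Definition _ := Quotient.on torus.

Definition torus_pi : 'rV[R]_d -> torus := \pi_torus.

Definition torus_dist (x y : torus) : R :=
  inf [set euclid_dist a b | a in torus_pi @^-1` [set x] & b in torus_pi @^-1` [set y]].

Definition torus_ball (x : torus) (r : R) : set torus :=
  [set y | torus_dist x y < r].

Definition torus_display : measure_display.
Proof. exact: default_measure_display. Qed.

(* A is measurable when its preimage under the projection is; this is the Borel
   sigma-algebra of the torus. *)
Let torus_measurable : set (set torus) :=
  image_set_system setT torus_pi measurable.

Let torus_sigma_algebra : sigma_algebra setT torus_measurable.
Proof. exact/sigma_algebra_image/sigma_algebra_measurable. Qed.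

Let torus_set0 : torus_measurable set0.
Proof. by case: torus_sigma_algebra. Qed.

Let torus_setC A : torus_measurable A -> torus_measurable (~` A).
Proof. by case: torus_sigma_algebra => _ + _ => /[apply]; rewrite setTD. Qed.

Let torus_bigcup (F : (set torus)^nat) :
  (forall i, torus_measurable (F i)) -> torus_measurable (\bigcup_i F i).
Proof. by case: torus_sigma_algebra => _ _; exact. Qed.

HB.instance Definition _ := @isMeasurable.Build torus_display torus
  torus_measurable torus_set0 torus_setC torus_bigcup.

Lemma measurable_torus_pi : measurable_fun setT torus_pi.
Proof. by []. Qed.

Definition unit_cube : set 'rV[R]_d :=
  [set x | forall i, 0 <= x ord0 i < 1].

Lemma measurable_unit_cube : measurable unit_cube.
Proof.
rewrite (_ : unit_cube =
    \bigcap_(i : 'I_d) ((fun x => x ord0 i) @^-1` `[0, 1[%classic)); last first.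
  apply/seteqP; split=> [x x01 i _|x x01 i].
    by rewrite /= in_itv/=; exact: x01.
  by have := x01 i I; rewrite /= in_itv.
apply: fin_bigcap_measurable => // i _; rewrite -[X in measurable X]setTI.
exact: measurable_row_coord.
Qed.

(* the image under the projection of Lebesgue measure on the unit cube *)
Definition torus_lebesgue : set torus -> \bar R :=
  pushforward (mrestr lebesgue_row measurable_unit_cube) torus_pi.

Let torus_lebesgue0 : torus_lebesgue set0 = 0%E.
Proof. by rewrite /torus_lebesgue /pushforward preimage_set0 measure0. Qed.

Let torus_lebesgue_ge0 A : (0 <= torus_lebesgue A)%E.
Proof. exact: (measure_ge0 (mrestr lebesgue_row measurable_unit_cube)). Qed.

Let torus_lebesgue_additive : semi_sigma_additive torus_lebesgue.
Proof.
exact: (pushforward_semi_sigma_additive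
  (m := mrestr lebesgue_row measurable_unit_cube) measurable_torus_pi).
Qed.

HB.instance Definition _ := isMeasure.Build _ _ _ torus_lebesgue
  torus_lebesgue0 torus_lebesgue_ge0 torus_lebesgue_additive.

End torus.
Arguments torus_pi {R d}.
Arguments torus_lebesgue {R d}.

(* The inverse is the one of \bar R, so the kernel is +oo on the diagonal. *)
Definition riesz_energy {R : realType} {d : nat} (t : R) (U : set (torus R d)) :
    \bar R :=
  (\int[torus_lebesgue]_(x in U) \int[torus_lebesgue]_(y in U)
     ((torus_dist x y `^ t)%:E)^-1)%E.

Section metric_measures.
Context {R : realType} {T : Type} (dist : T -> T -> R).

(* The element 0 makes the diameter of the empty set 0 instead of -oo. *)
Definition diameter (A : set T) : \bar R :=
  ereal_sup (0%E |` [set (dist x y)%:E | x in A & y in A]).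

Definition hausdorff_premeasure (t delta : R) (E : set T) : \bar R :=
  ereal_inf [set (\sum_(0 <= k <oo) (diameter (A k) `^ t))%E | A in
    [set A : (set T)^nat | E `<=` \bigcup_k A k /\
                           forall k, (diameter (A k) <= delta%:E)%E]].

Definition hausdorff_measure (t : R) (E : set T) : \bar R :=
  ereal_sup [set hausdorff_premeasure t delta E | delta in [set delta | 0 < delta]].

(* Restricting to t > 0 avoids the convention for 0 `^ 0 and does not change
   the infimum. *)
Definition hausdorff_dim (E : set T) : \bar R :=
  ereal_inf [set t%:E | t in [set t | 0 < t /\ hausdorff_measure t E = 0%E]].

End metric_measures.

Section large_intersection.
Context {R : realType} {d : nat}.

Definition dyadic_cube (n : int) (k : 'rV[int]_d) : set 'rV[R]_d :=
  [set x | forall i, (k ord0 i)%:~R * 2 ^ (- n) <= x ord0 i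
                     < (k ord0 i + 1)%:~R * 2 ^ (- n)].

Definition dyadic_cubes : set (set 'rV[R]_d) :=
  [set D | exists n k, D = dyadic_cube n k].

Definition dyadic_content (t : R) (E : set 'rV[R]_d) : \bar R :=
  ereal_inf [set \esum_(D in C) (diameter euclid_dist D `^ t)%E | C in
    [set C : set (set 'rV[R]_d) |
      [/\ countable C, C `<=` dyadic_cubes & E `<=` \bigcup_(D in C) D]]].

Definition large_intersection (s : R) : set (set 'rV[R]_d) :=
  [set E | Gdelta E /\
    forall D (t : R), dyadic_cubes D -> 0 < t < s ->
      (diameter euclid_dist D `^ t <= dyadic_content t (E `&` D))%E].

Definition torus_large_intersection (s : R) : set (set (torus R d)) :=
  [set E | large_intersection s (torus_pi @^-1` E)].

End large_intersection.

(* Main.v *)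
(* Fix t < s and suppose that countably many dyadic cubes D_k cover E_U in a
   dyadic cube D although sum |D_k|^t < |D|^t. Then D \ U D_k has positive Lebesgue
   measure. Call a dyadic cube good if it is contained in no D_k and the D_k
   inside it still have total t-content less than its own.
   The claim is that every good cube contains a smaller good cube lying in some
   U_j with j arbitrarily large; a nested sequence of good cubes then shrinks to
   a point of E_U outside all D_k. Suppose the claim fails in D. By a Vitali
   argument, almost every point outside the D_k lies in arbitrarily small good
   cubes, so for large j the D_k cover U_j almost everywhere in D. Cauchy-Schwarz on
   the blocks (U_j /\ D_k) x (U_j /\ D_k) of the double integral I_t(U_j), with
   the bound on I_t(U_j) lambda(B_j) / lambda(U_j)^2, shows that the D_k near B_j
   have t-content at least c lambda(B_j). Almost every point of D \ U D_k lies in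
   infinitely many B_j, and small balls meet only D_k with k > K, so the same
   Vitali argument bounds lambda(D \ U D_k) by a multiple of the tail
   sum_(k > K) |D_k|^t for every K; hence it vanishes, a contradiction. *)

Require Import Defs.
From HB Require Import structures.
From mathcomp Require Import all_boot all_order all_algebra.
From mathcomp Require Import all_classical all_reals all_analysis.
From mathcomp Require Import measurable_realfun borel_hierarchy.
From mathcomp Require Import ring lra zify.

Import Order.TTheory GRing.Theory Num.Theory.
Import numFieldNormedType.Exports.

Local Open Scope classical_set_scope.
Local Open Scope ring_scope.

Set Implicit Arguments.
Unset Strict Implicit.
Unset Printing Implicit Defensive.

(** * Dyadic cubes *)

Section dyadic.
Context {R : realType}.

(** Torus sets are studied through their lifts to the unit cube, where the projection is injective;
    balls that are small compared with the distance to its boundary lift without wrapping around.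
    Half-open dyadic cubes raise three obstacles. Nested cubes may have empty intersection, so each
    new good cube is chosen with its whole enlargement [nbr] inside the previous one. A small ball
    need not lie in a dyadic cube of comparable size, so one of the 3^d cubes around it is selected
    by pigeonhole. A point on a face has no neighbourhood inside its cube, so points with a dyadic
    coordinate are discarded as a null set. The t-content of the cover inside a cube is encoded as a
    measure made of point masses. It is then additive over disjoint cubes, and its tails tend to
    zero as soon as its total mass is finite. Two exponents occur because [s] is a supremum: the
    energy ratios are bounded at some [tt] above [t]. The gap costs nothing, since side^tt <= side^t
    for cubes of side at most 1. *)

Definition side (n : int) : R := 2 ^ (- n).

Definition dfloor (n : int) (a : R) : int := Num.floor (a * 2 ^ n).

Lemma side_gt0 n : 0 < side n.
Proof. by rewrite /side exprz_gt0. Qed.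

Lemma side_neq0 n : side n != 0.
Proof. by rewrite gt_eqF// side_gt0. Qed.

Lemma sideV n : (2 : R) ^ n = (side n)^-1.
Proof. by rewrite /side invr_expz opprK. Qed.

Lemma sideD n m : side (n + m) = side n * side m.
Proof. by rewrite /side opprD expfzDr. Qed.

Lemma le_side n m : n <= m -> side m <= side n.
Proof. by move=> nm; rewrite /side ler_eXz2l ?ltr1n// lerN2. Qed.

Lemma side_le1 n : 0 <= n -> side n <= 1.
Proof. by move=> n0; rewrite (_ : 1 = side 0) ?le_side. Qed.

Lemma dfloorP n a c : (dfloor n a == c) = (c%:~R * side n <= a < (c + 1)%:~R * side n).
Proof. by rewrite /dfloor floor_eq sideV ler_pdivlMr ?side_gt0// ltr_pdivrMr ?side_gt0. Qed.

Lemma dfloor_bound n a :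
  (dfloor n a)%:~R * side n <= a < (dfloor n a + 1)%:~R * side n.
Proof. by rewrite -dfloorP. Qed.

(** Comparing a floor with an integer amounts to comparing the number itself, and that comparison is
    invariant under scaling by 2^p. *)
Lemma dfloor_lt n (p : nat) a c :
  (dfloor n a < c) = (dfloor (n + p%:Z) a < c * 2 ^+ p).
Proof.
by rewrite /dfloor !floor_lt_int expfzDr// intrM rmorphXn/= -exprnP mulrA ltr_pM2r// exprn_gt0.
Qed.

(** With e = 0 this makes dyadic cubes nested; with e = 1 it makes their enlargements [nbr]
    nested. *)
Lemma dfloor_coarse n m a b (e : nat) : n <= m ->
  dfloor m a <= dfloor m b + e%:Z -> dfloor n a <= dfloor n b + e%:Z.
Proof.
move=> nm; have [p ->] : exists p : nat, m = n + p%:Z.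
  by exists `|m - n|%N; lia.
move=> ab; rewrite -ltzD1 (dfloor_lt _ p).
have : dfloor n b < dfloor n b + 1 by lia.
rewrite (dfloor_lt _ p) => bb.
have p1 : (1 : int) <= 2 ^+ p by rewrite exprn_ege1.
nia.
Qed.

Lemma dfloor_lt_int n a c : (dfloor n a < c) = (a < c%:~R * side n).
Proof. by rewrite /dfloor floor_lt_int sideV ltr_pdivrMr ?side_gt0. Qed.

Lemma dfloor_near n a b : `|a - b| < side n -> dfloor n a <= dfloor n b + 1.
Proof.
move=> ab; have /andP[_] := dfloor_bound n b; rewrite -ltzD1 dfloor_lt_int.
by move: ab; rewrite ltr_norml !intrD !mulrDl !mul1r => /andP[_]; lra.
Qed.

Lemma dfloor_eq_dist n a b : dfloor n a = dfloor n b -> `|a - b| < side n.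
Proof.
move=> ab; have := dfloor_bound n b; have := dfloor_bound n a.
by rewrite ab intrD mulrDl mul1r ltr_norml; lra.
Qed.

Lemma dfloor_near_dist n a b : `|dfloor n a - dfloor n b| <= 1 -> `|a - b| < 2 * side n.
Proof.
move=> ab; have := dfloor_bound n b; have := dfloor_bound n a.
have : dfloor n a < dfloor n b + 1 + 1 by lia.
have : dfloor n b < dfloor n a + 1 + 1 by lia.
rewrite !dfloor_lt_int !intrD !mulrDl !mul1r ltr_norml; lra.
Qed.

Lemma dfloor_shift (n : nat) a m : dfloor n (a + m%:~R) = dfloor n a + m * 2 ^+ n.
Proof.
rewrite /dfloor -exprnP mulrDl.
have -> : m%:~R * 2 ^+ n = (m * 2 ^+ n)%:~R :> R by rewrite intrM rmorphXn.
by rewrite floorDrz ?intr_int// intrKfloor.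
Qed.

Lemma dfloor_locally_const n a : a * 2 ^ n != (dfloor n a)%:~R ->
  exists2 e, 0 < e & forall b, `|b - a| < e -> dfloor n b = dfloor n a.
Proof.
move=> an; have /andP[la ra] := dfloor_bound n a.
have la' : (dfloor n a)%:~R * side n < a.
  rewrite lt_neqAle la andbT; apply: contraNneq an => ea.
  by rewrite -[X in X * _]ea sideV mulfK ?side_neq0.
exists (Num.min (a - (dfloor n a)%:~R * side n) ((dfloor n a + 1)%:~R * side n - a)).
  by rewrite lt_min !subr_gt0 la' ra.
move=> b; rewrite lt_min !ltr_norml => ab; apply/eqP; rewrite dfloorP; lra.
Qed.

Lemma exists_side_lt (e : R) : 0 < e -> exists n : nat, side n < e.
Proof.
move=> e0; exists (Num.truncn (e^-1)).+1.
rewrite /side -invr_expz -exprnP invf_plt ?posrE//.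
apply: lt_trans (truncnS_gt _) _.
by rewrite -natrX ltr_nat ltn_expl.
Qed.

Lemma exists_side_bracket (e : R) : 0 < e -> e < 1 ->
  exists n : nat, e <= side n < 2 * e.
Proof.
move=> e0 e1; have [N Ne] := exists_side_lt e0.
have ex : exists n, side n.+1 < e.
  exists N; apply: le_lt_trans Ne; apply: le_side; lia.
exists (ex_minn ex); case: ex_minnP => n ne nmin; apply/andP; split; last first.
  move: ne; rewrite -addn1 PoszD sideD (_ : side 1 = 2^-1)// ltr_pdivrMr//.
  by rewrite mulrC.
rewrite leNgt; apply/negP; case: n {ne} nmin => [|n] nmin ne.
  by move: ne; rewrite /side oppr0 expr0z ltNge ltW.
by have := nmin _ ne; rewrite ltnn.
Qed.

End dyadic.

Section cubes.
Context {R : realType} {d : nat}.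
Implicit Types (x y z : 'rV[R]_d) (k : 'rV[int]_d) (n m : int).

Local Notation cube := (@dyadic_cube R d).

Definition idx n x : 'rV[int]_d := \row_i dfloor n (x ord0 i).

Definition box z (e : R) : set 'rV[R]_d :=
  [set y | forall i, `|y ord0 i - z ord0 i| < e].

(** The union of the 3^d cubes of the same level around the cube. It contains the closure of the
    cube and serves as the enlarged ball of covering arguments. *)
Definition nbr n k : set 'rV[R]_d :=
  [set x | forall i, `|idx n x ord0 i - k ord0 i| <= 1].

Definition corner n k : 'rV[R]_d := \row_i ((k ord0 i)%:~R * side n).

(** At such a point the cube index is locally constant at every level, so every dyadic cube around
    it is a neighbourhood of it. *)
Definition nondyadic x :=
  forall (n : int) i, x ord0 i * 2 ^ n != (dfloor n (x ord0 i))%:~R.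

Lemma dyadic_cubeE n k : cube n k = [set x | idx n x = k].
Proof.
apply/seteqP; split=> x /=.
  move=> xk; apply/rowP => i; rewrite mxE; apply/eqP; rewrite dfloorP; exact: xk.
by move=> <- i; rewrite mxE -dfloorP.
Qed.

Lemma dyadic_cube_idx n x : cube n (idx n x) x.
Proof. by rewrite dyadic_cubeE. Qed.

Lemma idx_corner n k : idx n (corner n k) = k.
Proof.
apply/rowP => i; rewrite !mxE; apply/eqP; rewrite dfloorP lexx/= ltr_pM2r ?side_gt0//.
by rewrite ltr_int ltzD1.
Qed.

Lemma dyadic_cube_corner n k : cube n k (corner n k).
Proof. by rewrite dyadic_cubeE /= idx_corner. Qed.

Lemma idx_coarse n m x y : n <= m -> idx m x = idx m y -> idx n x = idx n y.
Proof.
move=> nm /rowP xy; apply/rowP => i; have := xy i; rewrite !mxE => xyi.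
have := @dfloor_coarse R n m (x ord0 i) (y ord0 i) 0 nm.
have := @dfloor_coarse R n m (y ord0 i) (x ord0 i) 0 nm.
by rewrite xyi !addr0 lexx => /(_ isT) ? /(_ isT) ?; apply/eqP; rewrite eq_le; apply/andP.
Qed.

Lemma nbr_coarse n m x y : n <= m -> nbr m (idx m y) x -> nbr n (idx n y) x.
Proof.
move=> nm xy i; have := xy i; rewrite !mxE => xyi.
have := @dfloor_coarse R n m (x ord0 i) (y ord0 i) 1 nm.
have := @dfloor_coarse R n m (y ord0 i) (x ord0 i) 1 nm.
lia.
Qed.

Lemma dyadic_cube_sub n m k l x : n <= m ->
  cube n k x -> cube m l x -> cube m l `<=` cube n k.
Proof.
by rewrite !dyadic_cubeE => nm /= <- <- y /= yx; rewrite (idx_coarse nm yx).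
Qed.

Lemma nbr_sub n m k l : n <= m ->
  cube  m l `<=` cube n k -> nbr m l `<=` (nbr n k : set 'rV[R]_d).
Proof.
move=> nm; have := dyadic_cube_corner m l; rewrite !dyadic_cubeE/=.
set y := corner m l => yl lk x; rewrite -(lk _ yl) -{1}yl.
exact: nbr_coarse.
Qed.

Lemma sub_nbr n k : cube n k `<=` nbr n k.
Proof. by rewrite dyadic_cubeE => x /= <- i; rewrite subrr normr0. Qed.

Lemma cube_sub_box n x e : side n <= e -> cube n (idx n x) `<=` box x e.
Proof.
rewrite dyadic_cubeE => ne y /= /rowP yx i; have := yx i; rewrite !mxE.
by move=> /dfloor_eq_dist/lt_le_trans; apply.
Qed.

Lemma nbr_sub_box n x e : 2 * side n <= e -> nbr n (idx n x) `<=` box x e.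
Proof.
move=> ne y yx i; have := yx i; rewrite !mxE => /dfloor_near_dist.
by move/lt_le_trans; apply.
Qed.

Lemma box_sub_nbr n x e : e <= side n -> box x e `<=` nbr n (idx n x).
Proof.
move=> en y yx i; rewrite !mxE.
have yxi : `|y ord0 i - x ord0 i| < side n by apply: lt_le_trans (yx i) en.
have := dfloor_near yxi; move: yxi; rewrite distrC => /dfloor_near.
lia.
Qed.

Lemma idx_locally_const n x : nondyadic x ->
  exists2 e, 0 < e & forall y, box x e y -> idx n y = idx n x.
Proof.
move=> ndx.
have /= h (i : 'I_d) : {e | 0 < e &
    forall b, `|b - x ord0 i| < e -> dfloor n b = dfloor n (x ord0 i)}.
  by apply: cid2; apply: dfloor_locally_const.
pose e i := let: exist2 a _ _ := h i in a.
exists (\big[Num.min/1]_i e i).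
  by apply: lt_bigmin => // i _; rewrite /e; case: (h i).
move=> y yx; apply/rowP => i; rewrite !mxE.
have := lt_le_trans (yx i) (bigmin_le_cond 1 e (isT : xpredT i)).
by rewrite /e; case: (h i) => e' _; apply.
Qed.

End cubes.

(** * Lebesgue measure of dyadic cubes *)

Section rectangles.
Context {R : realType}.

Lemma measurable_tuple_rect n (A : 'I_n -> set (measurableTypeR R)) :
  (forall i, measurable (A i)) ->
  measurable [set t : n.-tuple (measurableTypeR R) | forall i, A i (tnth t i)].
Proof.
move=> mA; rewrite (_ : [set _ | _] =
    \bigcap_(i : 'I_n) ((fun t => tnth t i) @^-1` A i)).
  apply: fin_bigcap_measurable => // i _; rewrite -[X in measurable X]setTI.
  exact: measurable_tnth.
by apply/seteqP; split=> [t tA i _|t tA i]; [exact: tA|exact: (tA i I)].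
Qed.

Lemma lebesgue_tuple_rect n (A : 'I_n -> set (measurableTypeR R)) (l : 'I_n -> R) :
  (forall i, measurable (A i)) -> (forall i, lebesgue_measure (A i) = (l i)%:E) ->
  lebesgue_tuple n [set t | forall i, A i (tnth t i)] = (\prod_i l i)%:E.
Proof.
elim: n A l => [|n IH] A l mA Al.
  by rewrite big_ord0 /= diracE mem_set// => -[].
rewrite /= /tuple_step /pushforward.
rewrite (_ : _ @^-1` _ = A ord0 `*`
    [set t : n.-tuple (measurableTypeR R) | forall i, A (lift ord0 i) (tnth t i)]).
  rewrite product_measure1E//; last exact: (measurable_tuple_rect (A := fun i => A (lift ord0 i))) .
  rewrite big_ord_recl EFinM; congr (_ * _)%E; first exact: Al.
  exact: (IH (fun i => A (lift ord0 i)) (fun i => l (lift ord0 i))).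
apply/seteqP; split=> -[a t] /=.
  move=> At; split; first by have := At ord0; rewrite tnth0.
  by move=> i; have := At (lift ord0 i); rewrite tnthS.
move=> [A0 At] i; case: (unliftP ord0 i) => [j ->|->]; last by rewrite tnth0.
by rewrite tnthS.
Qed.

Context {d : nat}.
Implicit Types (x y z : 'rV[R]_d) (k : 'rV[int]_d) (n m : int).
Local Notation cube := (@dyadic_cube R d).
Local Notation lam := (@lebesgue_row R d).

Lemma measurable_row_rect (A : 'I_d -> set (measurableTypeR R)) :
  (forall i, measurable (A i)) ->
  measurable [set x : 'rV[R]_d | forall i, A i (x ord0 i)].
Proof.
move=> mA; rewrite (_ : [set _ | _] =
    \bigcap_(i : 'I_d) ((fun x : 'rV[R]_d => x ord0 i) @^-1` A i)).
  apply: fin_bigcap_measurable => // i _; rewrite -[X in measurable X]setTI.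
  exact: measurable_row_coord.
by apply/seteqP; split=> [t tA i _|t tA i]; [exact: tA|exact: (tA i I)].
Qed.

Lemma lebesgue_row_rect (A : 'I_d -> set (measurableTypeR R)) (l : 'I_d -> R) :
  (forall i, measurable (A i)) -> (forall i, lebesgue_measure (A i) = (l i)%:E) ->
  lam [set x | forall i, A i (x ord0 i)] = (\prod_i l i)%:E.
Proof.
move=> mA Al; rewrite -(lebesgue_tuple_rect mA Al) /lebesgue_row /pushforward.
congr (lebesgue_tuple d _); apply/seteqP; split=> t /= tA i.
  by have := tA i; rewrite mxE.
by rewrite mxE.
Qed.

Definition dyadic_itv (n a b : int) : set (measurableTypeR R) :=
  `[a%:~R * side n, b%:~R * side n[%classic.

Lemma measurable_dyadic_itv n a b : measurable (dyadic_itv n a b).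
Proof. exact: measurable_itv. Qed.

Lemma lebesgue_dyadic_itv n a b : a < b ->
  lebesgue_measure (dyadic_itv n a b) = ((b - a)%:~R * side n)%:E.
Proof.
move=> ab; rewrite lebesgue_measure_itv/= lte_fin ltr_pM2r ?side_gt0// ltr_int ab.
by rewrite -EFinB intrB mulrBl.
Qed.

Lemma cube_rect n k : cube n k = [set x | forall i,
  dyadic_itv n (k ord0 i) (k ord0 i + 1) (x ord0 i)].
Proof.
by apply/seteqP; split=> x /= xk i; have := xk i; rewrite /dyadic_itv /= in_itv.
Qed.

Lemma nbr_rect n k : nbr n k = [set x : 'rV[R]_d | forall i,
  dyadic_itv n (k ord0 i - 1) (k ord0 i + 2) (x ord0 i)].
Proof.
apply/seteqP; split=> x /= xk i; have := xk i;
  rewrite /dyadic_itv /= in_itv/= mxE [X in X && _]leNgt -!dfloor_lt_int; lia.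
Qed.

Lemma measurable_cube n k : measurable (cube n k).
Proof.
rewrite cube_rect.
exact: (measurable_row_rect (fun i => measurable_dyadic_itv n (k ord0 i) (k ord0 i + 1))).
Qed.

Lemma measurable_nbr n k : measurable (nbr n k : set 'rV[R]_d).
Proof.
rewrite nbr_rect; exact: (measurable_row_rect
  (fun i => measurable_dyadic_itv n (k ord0 i - 1) (k ord0 i + 2))).
Qed.

Lemma lebesgue_cube n k : lam (cube n k) = (side n ^+ d)%:E.
Proof.
rewrite cube_rect (@lebesgue_row_rect (fun i => dyadic_itv n (k ord0 i) (k ord0 i + 1))
  (fun=> side n)).
- by rewrite prodr_const card_ord.
- by move=> i; exact: measurable_dyadic_itv.
- move=> i; rewrite lebesgue_dyadic_itv ?ltzD1//.
  by rewrite (_ : _ - _ = 1) ?mul1r//; lia.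
Qed.

Lemma lebesgue_nbr n k : lam (nbr n k) = (3 ^+ d * side n ^+ d)%:E.
Proof.
rewrite nbr_rect (@lebesgue_row_rect (fun i => dyadic_itv n (k ord0 i - 1) (k ord0 i + 2))
  (fun=> 3 * side n)).
- by rewrite prodr_const card_ord exprMn.
- by move=> i; exact: measurable_dyadic_itv.
- move=> i; rewrite lebesgue_dyadic_itv; last lia.
  by rewrite (_ : _ - _ = 3); last lia.
Qed.

Lemma lebesgue_cube_hyperplane n k (i : 'I_d) (c : R) :
  lam (cube n k `&` [set x | x ord0 i = c]) = 0%E.
Proof.
pose A j := dyadic_itv n (k ord0 j) (k ord0 j + 1) `&`
  (if j == i then [set c] else setT : set (measurableTypeR R)).
have mA j : measurable (A j).
  by apply: measurableI; [exact: measurable_dyadic_itv | case: ifP].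
have -> : cube n k `&` [set x | x ord0 i = c] = [set x | forall j, A j (x ord0 j)].
  rewrite cube_rect; apply/seteqP; split=> x /=.
    by move=> [xk xc] j; split; [exact: xk|case: ifP => // /eqP ->].
  by move=> xA; split=> [j|]; [case: (xA j)|case: (xA i); rewrite eqxx].
rewrite (@lebesgue_row_rect A (fun j => if j == i then 0 else side n))//.
  by rewrite (bigD1 i)//= eqxx mul0r.
move=> j; rewrite /A; case: ifP => _.
  apply/eqP; rewrite eq_le measure_ge0 andbT.
  apply: (@le_trans _ _ (lebesgue_measure [set c])); last by rewrite lebesgue_measure_set1.
  apply: le_measure; rewrite ?inE; [|exact: measurable_set1|exact: subIsetr].
  by apply: measurableI => //; exact: measurable_dyadic_itv.
rewrite setIT lebesgue_dyadic_itv ?ltzD1//.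
by rewrite (_ : _ - _ = 1) ?mul1r//; lia.
Qed.

Lemma negligible_countable_union (T : countType) (F : T -> set 'rV[R]_d) :
  (forall j, lam.-negligible (F j)) -> lam.-negligible (\bigcup_j F j).
Proof.
move=> F0.
apply: (@negligibleS _ _ _ _ (\bigcup_n (if unpickle n is Some j then F j else set0))).
  by move=> x [j _ Fx]; exists (pickle j) => //; rewrite pickleK.
apply: negligible_bigcup => n; case: unpickle => //; exact: negligible_set0.
Qed.

(** The excluded points lie on countably many hyperplanes, one for each level, coordinate and
    integer. Inside a fixed cube each hyperplane piece is a rectangle with one side of length
    zero. *)
Lemma negligible_dyadic_boundary n k : lam.-negligible (cube n k `&` ~` @nondyadic R d).
Proof.
pose F (j : int * 'I_d * int) :=
  cube n k `&` [set x : 'rV[R]_d | x ord0 j.1.2 = j.2%:~R * side j.1.1].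
apply: (@negligibleS _ _ _ _ (\bigcup_j F j)).
  move=> x [kx]; rewrite /nondyadic /setC/= => /existsNP[m] /existsNP[i] /negP.
  rewrite negbK => /eqP xmi; exists (m, i, dfloor m (x ord0 i)) => //; split=> //=.
  by rewrite -xmi sideV mulfVK ?side_neq0.
apply: negligible_countable_union => -[[m i] c].
exists (F (m, i, c)); split => //; last exact: lebesgue_cube_hyperplane.
apply: measurableI; first exact: measurable_cube.
rewrite -[X in measurable X]setTI.
exact: (measurable_row_coord i measurableT (measurable_set1 _)).
Qed.

(* The dyadic cubes are enumerated without repetition; the indices outside the
   range of the coding yield [None]. *)
Definition enum_cube (m : nat) : option (int * 'rV[int]_d) := pickle_inv m.

Definition ocube (o : option (int * 'rV[int]_d)) : set 'rV[R]_d :=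
  if o is Some (n, k) then cube n k else set0.

Lemma measurable_ocube o : measurable (ocube o).
Proof. by case: o => [[n k]|]; [exact: measurable_cube|exact: measurable0]. Qed.

Lemma open_box (O : set 'rV[R]_d) z : open O -> O z ->
  exists2 e, 0 < e & box z e `<=` O.
Proof.
move=> oO Oz; have : nbhs z O by exact: open_nbhs_nbhs.
rewrite -nbhs_ballE => -[e /= e0 eO]; exists e => // y yz.
apply: eO; split=> // i j; rewrite ord1 /ball/= distrC; exact: yz.
Qed.

Lemma open_cube (O : set 'rV[R]_d) z (N : int) : open O -> O z ->
  exists2 n : nat, (N <= n) & cube n (idx n z) `<=` O.
Proof.
move=> oO Oz; have [e e0 eO] := open_box oO Oz.
have [n ne] := exists_side_lt e0.
exists (n + `|N|)%N; first lia.
apply: subset_trans eO; apply: cube_sub_box; apply: le_trans (ltW ne).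
by apply: le_side; lia.
Qed.

(** The sigma-algebra is generated by the coordinates, so open sets are reached as countable unions
    of the dyadic cubes they contain. *)
Lemma measurable_open (O : set 'rV[R]_d) : open O -> measurable O.
Proof.
move=> oO; rewrite (_ : O = \bigcup_(m in [set m | ocube (enum_cube m) `<=` O])
    ocube (enum_cube m)).
  by apply: bigcup_measurable => m _; exact: measurable_ocube.
apply/seteqP; split=> x; last by move=> [m /= mO mx]; exact: mO.
move=> Ox; have [n _ nO] := open_cube 0 oO Ox.
exists (pickle (n%:Z, idx n x)) => /=; rewrite /enum_cube pickleK_inv//.
exact: dyadic_cube_idx.
Qed.

End rectangles.

(** * Riesz energy on the torus *)

Lemma sqr_sum_le_mul_sum {R : realFieldType} (I : finType) (P : pred I) (a c : I -> R) :
  (forall i, 0 < c i) ->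
  (\sum_(i | P i) a i) ^+ 2 <=
  (\sum_(i | P i) c i * a i ^+ 2) * (\sum_(i | P i) (c i)^-1).
Proof.
move=> c0; case: (pickP P) => [i0 Pi0|P0]; last first.
  by rewrite !big_pred0// expr0n mul0r.
set S := \sum_(i | P i) c i * _; set W := \sum_(i | P i) (c i)^-1.
set A := \sum_(i | P i) a i.
have W0 : 0 < W.
  rewrite /W (bigD1 i0)//= ltr_pwDl ?invr_gt0// sumr_ge0// => i _.
  by rewrite invr_ge0 ltW.
(* A / (W c_i) is the minimiser of the weighted sum of squares among families of total A. *)
have : 0 <= \sum_(i | P i) c i * (a i - A / W / c i) ^+ 2.
  by apply: sumr_ge0 => i _; rewrite mulr_ge0 ?sqr_ge0// ltW.
have -> : \sum_(i | P i) c i * (a i - A / W / c i) ^+ 2 =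
    \sum_(i | P i) (c i * a i ^+ 2 - 2 * (A / W) * a i + (A / W) ^+ 2 * (c i)^-1).
  by apply: eq_bigr => i _; field; rewrite !gt_eqF.
rewrite big_split sumrB/= -!mulr_sumr -/A -/W -/S.
have -> : S - 2 * (A / W) * A + (A / W) ^+ 2 * W = S - A ^+ 2 / W by field; rewrite gt_eqF.
by rewrite subr_ge0 ler_pdivrMr.
Qed.

Section integral_lower_bounds.
Context d (T : measurableType d) (R : realType) (mu : {measure set T -> \bar R}).
Local Open Scope ereal_scope.
Import HBNNSimple.

(** The integral of a nonnegative function is a supremum over the simple functions below it, hence
    monotone for arbitrary functions. This suits a kernel of which only lower bounds on blocks are
    known. *)
Lemma ge0_le_integral_nomeas (D : set T) (f g : T -> \bar R) :
  (forall x, D x -> 0 <= f x) -> (forall x, D x -> f x <= g x) ->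
  \int[mu]_(x in D) f x <= \int[mu]_(x in D) g x.
Proof.
move=> f0 fg; rewrite !ge0_integralE//; last first.
  by move=> x Dx; exact: le_trans (f0 _ Dx) (fg _ Dx).
apply: ge_ereal_sup => _ [h/= hf <-].
apply: le_ereal_sup_tmp; exists (sintegral mu h) => //; exists h => // x.
apply: le_trans (hf x) _; rewrite /patch; case: ifPn => //; rewrite inE; exact: fg.
Qed.

(* Cauchy-Schwarz on the blocks A_i * A_i of the double integral. *)
Lemma sqr_measure_le_energy (U : set T) (K : T -> T -> \bar R) (I : finType) (P : pred I)
    (A : I -> set T) (c : I -> R) :
  measurable U -> mu U < +oo -> (forall x y, 0 <= K x y) ->
  (forall i, measurable (A i)) -> (forall i, A i `<=` U) -> trivIset setT A ->
  (forall i, 0 < c i)%R ->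
  (forall i x y, A i x -> A i y -> (c i)%:E <= K x y) ->
  (\sum_(i | P i) mu (A i)) ^+ 2 <=
  (\int[mu]_(x in U) \int[mu]_(y in U) K x y) * (\sum_(i | P i) (c i)^-1)%:E.
Proof.
move=> mU Ufin K0 mA AU tA c0 cK.
pose a i := fine (mu (A i)).
have aE i : mu (A i) = (a i)%:E.
  rewrite fineK// ge0_fin_numE ?measure_ge0//.
  by apply: le_lt_trans Ufin; apply: le_measure; rewrite ?inE.
have a0 i : (0 <= a i)%R by rewrite fine_ge0.
rewrite (eq_bigr (fun i => (a i)%:E))// sumEFin -EFin_expe.
have W0 : (0 <= \sum_(i | P i) (c i)^-1)%R by apply: sumr_ge0 => i _; rewrite invr_ge0 ltW.
apply: (@le_trans _ _ ((\sum_(i | P i) c i * a i ^+ 2)%:E * (\sum_(i | P i) (c i)^-1)%:E)).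
  by rewrite -EFinM lee_fin sqr_sum_le_mul_sum.
apply: lee_wpmul2r; first by rewrite lee_fin.
have indAU i : \int[mu]_(x in U) (\1_(A i) x)%:E = (a i)%:E.
  by rewrite integral_indic// -aE; congr (mu _); apply/setIidPl/AU.
apply: (@le_trans _ _ (\int[mu]_(x in U)
    \sum_(i <- [seq i <- index_enum I | P i]) (c i * a i)%:E * (\1_(A i) x)%:E)).
  rewrite ge0_integral_sum//; last 2 first.
  - move=> i; apply: emeasurable_funM; first exact: measurable_cst.
    by apply/measurable_EFinP; exact: measurable_indic.
  - move=> i x _; rewrite mule_ge0// lee_fin; first by rewrite mulr_ge0// ltW.
  rewrite big_filter -sumEFin le_eqVlt; apply/orP; left; apply/eqP; apply: eq_bigr => i _.
  rewrite ge0_integralZl_EFin//; last 2 first.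
  - by apply/measurable_EFinP; exact: measurable_indic.
  - by rewrite mulr_ge0// ltW.
  by rewrite indAU -EFinM -mulrA -expr2.
apply: ge0_le_integral_nomeas.
  move=> x Ux; apply: sume_ge0 => i _; rewrite mule_ge0// lee_fin.
  by rewrite mulr_ge0// ltW.
move=> x Ux; rewrite big_filter; have [[i Pi Aix]|NA] := pselect (exists2 i, P i & A i x); last first.
  rewrite big1 ?integral_ge0// => i Pi; rewrite indicE memNset ?mule0//.
  by move=> Aix; apply: NA; exists i.
rewrite (bigD1 i)//= big1 ?adde0; last first.
  move=> j /andP[_ ji]; rewrite indicE memNset ?mule0// => Ajx; move/eqP: ji; apply.
  by apply: tA => //; exists x.
rewrite indicE mem_set// mule1 EFinM -indAU -ge0_integralZl_EFin//; last 2 first.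
- by apply/measurable_EFinP; exact: measurable_indic.
- exact: ltW.
apply: ge0_le_integral_nomeas.
  by move=> y _; rewrite mule_ge0// lee_fin// ltW.
move=> y Uy; rewrite indicE; have [Aiy|NAiy] := pselect (A i y).
  by rewrite mem_set// mule1 cK.
by rewrite memNset// mule0.
Qed.

End integral_lower_bounds.

Section torus.
Context {R : realType} {d : nat}.
Implicit Types (a b z : 'rV[R]_d) (k : 'rV[int]_d).
Local Notation pi := (@torus_pi R d).
Local Notation lam := (@lebesgue_row R d).

Lemma euclid_norm_ge0 a : 0 <= euclid_norm a.
Proof. exact: sqrtr_ge0. Qed.

Lemma euclid_dist_ge_coord a b i : `|a ord0 i - b ord0 i| <= euclid_dist a b.
Proof.
rewrite -sqrtr_sqr ler_wsqrtr// (bigD1 i)//= !mxE lerDl.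
by apply: sumr_ge0 => j _; exact: sqr_ge0.
Qed.

Lemma euclid_dist_le_coord a b (e : R) : 0 <= e ->
  (forall i, `|a ord0 i - b ord0 i| <= e) -> euclid_dist a b <= Num.sqrt d%:R * e.
Proof.
move=> e0 abe; rewrite -[X in _ * X](ger0_norm e0) -sqrtr_sqr -sqrtrM//.
apply: ler_wsqrtr; rewrite mulr_natl -[X in _ *+ X]card_ord -sumr_const.
apply: ler_sum => i _; rewrite !mxE -real_normK ?num_real//.
by rewrite ler_pXn2r ?nnegrE.
Qed.

Lemma torus_piP a b : reflect (exists k, a - b = map_mx intr k) (pi a == pi b).
Proof.
apply: (iffP idP).
  by move=> /eqP/eqquotP; rewrite /= => /asboolP.
by move=> abk; apply/eqP/eqquotP => /=; apply/asboolP.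
Qed.

Lemma torus_pi_shift a k : pi (a + map_mx intr k) = pi a.
Proof. by apply/eqP/torus_piP; exists k; rewrite addrC addKr. Qed.

Lemma torus_pi_surj (x : torus R d) : exists a, pi a = x.
Proof. by exists (repr x); rewrite /torus_pi reprK. Qed.

Lemma torus_dist_le a b : torus_dist (pi a) (pi b) <= euclid_dist a b.
Proof.
apply: ge_inf; last by exists a => //; exists b.
by exists 0 => _ [? _ [? _ <-]]; exact: euclid_norm_ge0.
Qed.

(** The infimum ranges over the lifts of both points; an integer translation of a near-optimal pair
    turns its first lift into [a]. *)
Lemma torus_dist_lift a (y : torus R d) r : torus_dist (pi a) y < r ->
  exists2 b, pi b = y & euclid_dist a b < r.
Proof.
move=> /inf_lt -[|_ [a' a'a [b' b'y <-]] a'b'r].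
  have [b by_] := torus_pi_surj y.
  by exists (euclid_dist a b), a => //; exists b.
have /eqP/torus_piP[k a'ak] : pi a' = pi a by [].
exists (b' - map_mx intr k); first by rewrite -map_mxN torus_pi_shift.
rewrite /euclid_dist opprB addrCA addrA -a'ak subrK; move: a'b'r.
by rewrite /euclid_dist.
Qed.

Lemma euclid_dist_continuous a : continuous (euclid_dist a).
Proof.
have coordc i : continuous (fun b : 'rV[R]_d => a ord0 i - b ord0 i).
  move=> b; exact: (cvgB (cvg_cst _) (@coord_continuous R 1 d ord0 i b)).
have sqrc i : continuous (fun b : 'rV[R]_d => (a ord0 i - b ord0 i) ^+ 2).
  move=> b; exact: (continuous_comp (coordc i b) (@exprn_continuous R 2 _)).
have sumc (s : seq 'I_d) :
    continuous (fun b : 'rV[R]_d => \sum_(i <- s) (a ord0 i - b ord0 i) ^+ 2).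
  elim: s => [|i s IH] b.
    by under eq_fun do rewrite big_nil; exact: cst_continuous.
  under eq_fun do rewrite big_cons; exact: (cvgD (sqrc i b) (IH b)).
rewrite (_ : euclid_dist a = fun b =>
    Num.sqrt (\sum_i (a ord0 i - b ord0 i) ^+ 2)); last first.
  by apply/funext => b; congr Num.sqrt; apply: eq_bigr => i _; rewrite !mxE.
move=> b; exact: (continuous_comp (sumc _ b) (@sqrt_continuous R _)).
Qed.

Lemma torus_ball_preimage a r : pi @^-1` torus_ball (pi a) r =
  \bigcup_k [set b | euclid_dist a (b + map_mx intr k) < r].
Proof.
apply/seteqP; split=> b /=.
  move=> /torus_dist_lift[b' /eqP/torus_piP[k b'b] ab']; exists k => //=.
  by rewrite -b'b addrC subrK.
move=> [k _ /= abk]; apply: le_lt_trans abk.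
by rewrite -(torus_pi_shift b k); exact: torus_dist_le.
Qed.

Lemma torus_ball_open (x : torus R d) r : open (torus_ball x r).
Proof.
have [a <-] := torus_pi_surj x.
change (open (pi @^-1` torus_ball (pi a) r)); rewrite torus_ball_preimage.
apply: bigcup_open => k _.
have ck : continuous (fun b : 'rV[R]_d => b + map_mx intr k).
  move=> b; exact: (cvgD cvg_id (cvg_cst _)).
have cf : continuous (fun b => euclid_dist a (b + map_mx intr k)).
  move=> b; exact: (continuous_comp (ck b) (@euclid_dist_continuous a _)).
exact: (open_comp (fun b _ => cf b) (@open_lt R r)).
Qed.

Lemma torus_lebesgueE (A : set (torus R d)) :
  torus_lebesgue A = lam (pi @^-1` A `&` @unit_cube R d).
Proof. by []. Qed.

Lemma measurable_torusE (A : set (torus R d)) :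
  measurable A <-> measurable (pi @^-1` A).
Proof. by rewrite [X in X <-> _]/measurable/= /image_set_system /= setTI. Qed.

Lemma unit_cubeE : @unit_cube R d = dyadic_cube 0 0 :> set 'rV[R]_d.
Proof.
by apply/seteqP; split=> x /= h i; have := h i; rewrite mxE oppr0 expr0z !mulr1 add0r.
Qed.

End torus.

Section lifts.
Context {R : realType} {d : nat}.
Implicit Types (a b z : 'rV[R]_d) (k : 'rV[int]_d).
Local Notation pi := (@torus_pi R d).
Local Notation lam := (@lebesgue_row R d).
Local Notation cube := (@dyadic_cube R d).

Lemma measurable_row_fun (f : 'rV[R]_d -> 'rV[R]_d) :
  (forall i, measurable_fun setT (fun x => f x ord0 i : measurableTypeR R)) ->
  measurable_fun setT f.
Proof.
move=> mf; apply: (@measurability _ _ _ _ setT f (\big[setU/set0]_(i < d)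
  preimage_set_system setT (fun x : 'rV[R]_d => x ord0 i : measurableTypeR R) measurable)) => //.
move=> _ [B + <-]; rewrite -bigcup_seq => -[i _ [C mC <-]].
by rewrite !setTI -[X in measurable X]setTI; exact: (mf i measurableT C mC).
Qed.

Lemma measurable_row_shift (v : 'rV[R]_d) :
  measurable_fun setT (fun x : 'rV[R]_d => x + v).
Proof.
apply: measurable_row_fun => i; under eq_fun do rewrite mxE.
by apply: measurable_funD; [exact: measurable_row_coord|exact: measurable_cst].
Qed.

(** The full preimage of the image is the countable union of the integer translates of A. *)
Lemma measurable_torus_image (A : set 'rV[R]_d) : measurable A -> measurable (pi @` A).
Proof.
move=> mA; apply/measurable_torusE.
rewrite (_ : _ @^-1` _ = \bigcup_n (if unpickle n is Some k then
    (fun x => x + map_mx intr (k : 'rV[int]_d)) @^-1` A else set0)).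
  apply: bigcupT_measurable => n; case: unpickle => // k.
  by rewrite -[X in measurable X]setTI; apply: measurable_row_shift.
apply/seteqP; split=> x /=.
  move=> [a Aa /eqP/torus_piP[k ak]]; exists (pickle k) => //.
  by rewrite pickleK /= -ak addrC subrK.
move=> [n _]; case: unpickle => // k /= Ak; exists (x + map_mx intr k) => //.
exact: torus_pi_shift.
Qed.

Lemma torus_pi_unit_inj x y : unit_cube x -> unit_cube y -> pi x = pi y -> x = y.
Proof.
move=> x01 y01 /eqP/torus_piP[k xyk]; apply/rowP => i.
move/rowP: xyk => /(_ i); rewrite !mxE => xyi.
have /andP[x0 x1] := x01 i; have /andP[y0 y1] := y01 i.
have k1 : k ord0 i < 1 by rewrite -(ltr_int R) -xyi; lra.
have k1' : -1 < k ord0 i by rewrite -(ltr_int R) -xyi; lra.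
have k0 : k ord0 i = 0 by lia.
by move: xyi; rewrite k0; lra.
Qed.

Lemma torus_lebesgue_image (A : set 'rV[R]_d) : A `<=` @unit_cube R d ->
  torus_lebesgue (pi @` A) = lam A.
Proof.
move=> A01; rewrite torus_lebesgueE; congr (lam _); apply/seteqP; split=> x /=.
  by move=> [[a Aa /torus_pi_unit_inj ax] x01]; rewrite -ax//; exact: A01.
by move=> Ax; split; [exists x|exact: A01].
Qed.

Lemma torus_lebesgue_fin (A : set (torus R d)) : measurable A ->
  torus_lebesgue A \is a fin_num.
Proof.
move=> /measurable_torusE mA; rewrite ge0_fin_numE// torus_lebesgueE.
apply: (@le_lt_trans _ _ (lam (@unit_cube R d))).
  apply: le_measure; rewrite ?inE//; last exact: measurable_unit_cube.
  by apply: measurableI => //; exact: measurable_unit_cube.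
by rewrite unit_cubeE lebesgue_cube ltry.
Qed.

(** The projection does not increase distances, so the kernel is at least delta_i^-t on the image of
    A_i. On the unit cube it is injective, so the images stay disjoint and keep their measures. *)
Lemma sqr_lebesgue_le_riesz_energy (t : R) (U : set (torus R d)) (I : finType)
    (P : pred I) (A : I -> set 'rV[R]_d) (delta : I -> R) :
  0 < t -> measurable U -> (forall i, measurable (A i)) ->
  (forall i, A i `<=` pi @^-1` U `&` @unit_cube R d) -> trivIset setT A ->
  (forall i, 0 < delta i) ->
  (forall i x y, A i x -> A i y -> euclid_dist x y <= delta i) ->
  ((\sum_(i | P i) lam (A i)) ^+ 2 <=
   riesz_energy t U * (\sum_(i | P i) delta i `^ t)%:E)%E.
Proof.
move=> t0 mU mA AU tA d0 Ad.
have -> : (\sum_(i | P i) lam (A i) =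
    \sum_(i | P i) torus_lebesgue (pi @` A i))%E.
  by apply: eq_bigr => i _; rewrite torus_lebesgue_image// => x /AU[].
have -> : \sum_(i | P i) delta i `^ t = \sum_(i | P i) ((delta i `^ t)^-1)^-1.
  by apply: eq_bigr => i _; rewrite invrK.
apply: (@sqr_measure_le_energy _ _ _ (@torus_lebesgue R d) U
  (fun x y => ((torus_dist x y `^ t)%:E)^-1)%E) => //.
- have := torus_lebesgue_fin mU; by rewrite ge0_fin_numE.
- by move=> x y; rewrite inve_ge0 lee_fin powR_ge0.
- by move=> i; exact: measurable_torus_image.
- by move=> i _ [x Ax <-]; case: (AU _ _ Ax).
- move=> i j _ _ [_ [[x Ax <-] [y Ay /torus_pi_unit_inj]]] yx.
  have [_ x01] := AU _ _ Ax; have [_ y01] := AU _ _ Ay.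
  by apply: tA => //; exists x; split => //; rewrite -yx.
- by move=> i; rewrite invr_gt0 powR_gt0.
- move=> i _ _ [x Ax <-] [y Ay <-].
  (* At distance zero the kernel is +oo and the bound is trivial. *)
  have [D0|D0] := eqVneq (torus_dist (pi x) (pi y) `^ t) 0; first by rewrite D0 inve0 leey.
  have p0 : 0 < torus_dist (pi x) (pi y) `^ t by rewrite lt0r D0 powR_ge0.
  have p1 : 0 < delta i `^ t by rewrite powR_gt0.
  rewrite inver (negPf D0) lee_fin lef_pV2 ?posrE//.
  have D0' : 0 <= torus_dist (pi x) (pi y).
    apply: lb_le_inf; first by exists (euclid_dist x y), x => //; exists y.
    by move=> _ [? _ [? _ <-]]; exact: euclid_norm_ge0.
  apply: ge0_ler_powR => //; rewrite ?nnegrE//; first exact: ltW.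
  - exact: ltW.
  - exact: le_trans (torus_dist_le _ _) (Ad _ _ _ Ax Ay).
Qed.

Lemma torus_lift_unit (x : torus R d) : exists2 a, pi a = x & unit_cube a.
Proof.
have [a ax] := torus_pi_surj x.
exists (a + map_mx intr (\row_i - Num.floor (a ord0 i))); first by rewrite torus_pi_shift.
move=> i; rewrite !mxE; have := floor_itv (a ord0 i).
by rewrite intrD mulrNz; lra.
Qed.

Lemma unit_cube_sub n z : (0 <= n) -> unit_cube z ->
  cube n (idx n z) `<=` @unit_cube R d.
Proof.
rewrite unit_cubeE => n0 z01.
exact: dyadic_cube_sub n0 z01 (dyadic_cube_idx _ _).
Qed.

Lemma torus_lebesgue_open_gt0 (U : set (torus R d)) : open U -> U !=set0 ->
  (0 < torus_lebesgue U)%E.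
Proof.
move=> oU [x Ux]; have [a ax a01] := torus_lift_unit x.
have oU' : open (pi @^-1` U) := oU.
have Ua : (pi @^-1` U) a by rewrite /= ax.
have [n _ nU] := open_cube 0 oU' Ua.
rewrite torus_lebesgueE; apply: (@lt_le_trans _ _ (lam (cube n (idx n a)))).
  by rewrite lebesgue_cube lte_fin exprn_gt0 ?side_gt0.
apply: le_measure; rewrite ?inE.
- exact: measurable_cube.
- by apply: measurableI; [exact: measurable_open|exact: measurable_unit_cube].
- by move=> y ay; split; [exact: nU|exact: unit_cube_sub ay].
Qed.

End lifts.

(** * Covers by dyadic cubes *)

Section cube_measures.
Context {R : realType} {d : nat}.
Local Notation I := (option (int * 'rV[int]_d)).
Implicit Types (x y z : 'rV[R]_d) (k : 'rV[int]_d) (t : R).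
Local Notation lam := (@lebesgue_row R d).
Local Notation cube := (@dyadic_cube R d).
Local Notation ocube := (@ocube R d).

Definition cube_weight t (o : I) : R := if o is Some (n, _) then side n `^ t else 0.

Lemma cube_weight_ge0 t o : 0 <= cube_weight t o.
Proof. by case: o => [[n k]|] //=; exact: powR_ge0. Qed.

Definition ocorner (o : I) : 'rV[R]_d := if o is Some (n, k) then corner n k else 0.

Definition corner_mass t (q : nat -> I) (i : nat) : {measure set 'rV[R]_d -> \bar R} :=
  mscale (NngNum (cube_weight_ge0 t (q i))) (dirac (ocorner (q i))).

(* Each cube of the cover [q] is a point mass at its lower corner, which belongs
   to every dyadic cube containing it. *)
Definition tail_mass t (q : nat -> I) (K : nat) : {measure set 'rV[R]_d -> \bar R} :=
  mseries (corner_mass t q) K.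

Lemma corner_massE t q i A :
  corner_mass t q i A = ((cube_weight t (q i))%:E * \d_(ocorner (q i)) A)%E.
Proof. by []. Qed.

Lemma corner_mass_in t q i A : A (ocorner (q i)) -> corner_mass t q i A = (cube_weight t (q i))%:E.
Proof. by move=> Aq; rewrite corner_massE diracE mem_set// mule1. Qed.

Lemma tail_massE t q K A : tail_mass t q K A = (\sum_(K <= i <oo) corner_mass t q i A)%E.
Proof. by []. Qed.

Lemma tail_massT t q K : tail_mass t q K setT = (\sum_(K <= i <oo) (cube_weight t (q i))%:E)%E.
Proof.
by rewrite tail_massE; apply: eq_eseriesr => i _; rewrite corner_mass_in.
Qed.

Lemma tail_mass_eq t q K A : (forall i, (i < K)%N -> ocube (q i) `&` A = set0) ->
  tail_mass t q 0 A = tail_mass t q K A.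
Proof.
move=> qA; rewrite !tail_massE (@nneseries_split _ _ 0 K)// add0n big1_seq ?add0e//.
move=> i /=; rewrite mem_index_iota => /= iK; rewrite corner_massE.
case qi : (q i) => [[m l]|]; last by rewrite mul0e.
rewrite diracE memNset ?mule0//= => Al.
have : (ocube (q i) `&` A) (corner m l).
  by split => //; rewrite qi; exact: dyadic_cube_corner.
by rewrite qA.
Qed.

Lemma tail_mass_ge t q K A i : (K <= i)%N -> A (ocorner (q i)) ->
  ((cube_weight t (q i))%:E <= tail_mass t q K A)%E.
Proof.
move=> Ki Aq; rewrite tail_massE.
apply: le_trans (@nneseries_lim_ge _ _ _ _ i.+1 _) => //.
rewrite big_nat_recr//= corner_mass_in//.
by rewrite leeDr// sume_ge0.
Qed.

Lemma tail_mass_cvg0 t q : (tail_mass t q 0 setT < +oo)%E ->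
  tail_mass t q K setT @[K --> \oo] --> 0%E.
Proof.
rewrite tail_massT => qoo; under eq_fun do rewrite tail_massT.
by apply: nneseries_tail_cvg => // i _; rewrite lee_fin cube_weight_ge0.
Qed.

(* Maximal cubes of a family of dyadic cubes are disjoint, and the
   neighbourhood [nbr] of a cube is contained in that of every dyadic cube
   containing it: this plays the role of the Vitali covering lemma. *)
Lemma dyadic_vitali (nu : {measure set 'rV[R]_d -> \bar R}) (N : int) (c : R)
    (F : set (int * 'rV[int]_d)) :
  0 < c ->
  (forall n k, F (n, k) -> N <= n /\ ((c * side n ^+ d)%:E <= nu (cube n k))%E) ->
  exists V : set 'rV[R]_d, [/\ measurable V,
    forall n k, F (n, k) -> nbr n k `<=` V &
    (lam V <= (3 ^+ d / c)%:E * nu setT)%E].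
Proof.
move=> c0 FN.
(* The maximal cubes of F: no coarser cube of level at least N around the same corner belongs to F.
   The lower bound N on levels makes a coarsest one exist. *)
pose M (p : int * 'rV[int]_d) := F p /\
  forall n, N <= n -> n < p.1 -> ~ F (n, idx n (corner p.1 p.2 : 'rV[R]_d)).
have Mex n k : F (n, k) ->
    exists m l, M (m, l) /\ nbr n k `<=` (nbr m l : set 'rV[R]_d).
  move=> Fnk; have [Nn _] := FN _ _ Fnk.
  pose x : 'rV[R]_d := corner n k.
  have ex : exists m : nat, `[< F (N + m%:Z, idx (N + m%:Z) x) >].
    exists `|n - N|%N; apply/asboolP; rewrite (_ : N + _ = n); last lia.
    by rewrite idx_corner.
  case: (ex_minnP ex) => m /asboolP Fm mmin.
  have mn : N + m%:Z <= n.
    suff : (m <= `|n - N|)%N by lia.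
    apply: mmin; apply/asboolP; rewrite (_ : N + _ = n); last lia.
    by rewrite idx_corner.
  exists (N + m%:Z), (idx (N + m%:Z) x); split.
    split => // n' Nn' /= n'm.
    rewrite (@idx_coarse _ _ n' (N + m%:Z) _ x) ?idx_corner//; last exact: ltW.
    have -> : n' = N + `|n' - N|%N by lia.
    move=> /asboolP/mmin; lia.
  apply: nbr_sub => //; apply: (@dyadic_cube_sub _ _ _ _ _ _ x) => //.
    exact: dyadic_cube_idx.
  exact: dyadic_cube_corner.
pose G (m : nat) : I := if enum_cube m is Some p then if `[< M p >] then Some p else None else None.
have GM m p : G m = Some p -> M p /\ m = pickle p.
  rewrite /G /enum_cube; have := @pickle_invK (int * 'rV[int]_d)%type m.
  case: pickle_inv => //= p' pm; case: asboolP => // Mp' [<-].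
  by split; rewrite ?pm.
have GE p : M p -> exists m, G m = Some p.
  by move=> Mp; exists (pickle p); rewrite /G /enum_cube pickleK_inv; case: asboolP.
pose onbr (o : I) : set 'rV[R]_d := if o is Some (n, k) then nbr n k else set0.
have monbr o : measurable (onbr o).
  by case: o => [[n k]|] /=; [exact: measurable_nbr|exact: measurable0].
exists (\bigcup_m onbr (G m)); split.
- exact: bigcupT_measurable.
- move=> n k /Mex[m [l [Ml nm]]]; apply: (subset_trans nm) => x xl.
  by have [j Gj] := GE _ Ml; exists j => //; rewrite Gj.
- have tG : trivIset setT (fun m => ocube (G m)).
    move=> m1 m2 _ _ [x []].
    case E1 : (G m1) => [[n1 k1]|]//; case E2 : (G m2) => [[n2 k2]|]//=.
    have [[F1 M1] ->] := GM _ _ E1; have [[F2 M2] ->] := GM _ _ E2.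
    rewrite !dyadic_cubeE /= => x1 x2.
    have [n12|n21|n12] := ltgtP n1 n2.
    + have [N1 _] := FN _ _ F1; exfalso; apply: (M2 n1) => //=.
      by rewrite (@idx_coarse _ _ n1 n2 _ x) ?x1 ?idx_corner//; exact: ltW.
    + have [N2 _] := FN _ _ F2; exfalso; apply: (M1 n2) => //=.
      by rewrite (@idx_coarse _ _ n2 n1 _ x) ?x2 ?idx_corner//; exact: ltW.
    + by rewrite -x1 -x2 n12.
  apply: (@le_trans _ _ (\sum_(m <oo) lam (onbr (G m)))%E).
    by apply: generalized_Boole_inequality => //; exact: bigcupT_measurable.
  apply: (@le_trans _ _ (\sum_(m <oo) (3 ^+ d / c)%:E * nu (ocube (G m)))%E).
    apply: lee_nneseries => // m _.
    case Em : (G m) => [[n k]|] /=; last by rewrite !measure0 mule0.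
    have [[Fn _] _] := GM _ _ Em; have [_ cn] := FN _ _ Fn.
    rewrite lebesgue_nbr.
    apply: (@le_trans _ _ ((3 ^+ d / c)%:E * (c * side n ^+ d)%:E)%E).
      by rewrite -EFinM lee_fin mulrA mulfVK// gt_eqF.
    by rewrite lee_wpmul2l// lee_fin divr_ge0 ?exprn_ge0// ltW.
  rewrite nneseriesZl// lee_wpmul2l//; first by rewrite lee_fin divr_ge0 ?exprn_ge0// ltW.
  rewrite -measure_semi_bigcup//.
  + apply: le_measure; rewrite ?inE//.
    by apply: bigcupT_measurable => m; exact: measurable_ocube.
  + by move=> m; exact: measurable_ocube.
  + by apply: bigcupT_measurable => m; exact: measurable_ocube.
Qed.

(** For each K the covering lemma encloses S in a set of measure at most 3^d / c times the tail mass
    from K on; the intersection of these sets over K is null. *)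
Lemma negligible_of_tails t q (N : int) (c : R) (S : set 'rV[R]_d) :
  0 < c -> (tail_mass t q 0 setT < +oo)%E ->
  (forall K z, S z -> exists n k, [/\ N <= n, nbr n k z &
     ((c * side n ^+ d)%:E <= tail_mass t q K (cube n k))%E]) ->
  lam.-negligible S.
Proof.
move=> c0 qoo SN.
have VK K := @dyadic_vitali (tail_mass t q K) N c
  [set p | N <= p.1 /\ ((c * side p.1 ^+ d)%:E <= tail_mass t q K (cube p.1 p.2))%E]
  c0 (fun n k => id).
have [V HV] := choice VK.
have mV : measurable (\bigcap_K V K) by apply: bigcapT_measurable => K; case: (HV K).
exists (\bigcap_K V K); split => //; last first.
  move=> z Sz K _; have [n [k [Nn nz cn]]] := SN K z Sz.
  by case: (HV K) => _ /(_ n k) h _; apply: h nz.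
apply/eqP; rewrite eq_le measure_ge0 andbT.
have cv : ((3 ^+ d / c)%:E * tail_mass t q K setT @[K --> \oo] --> 0)%E.
  by rewrite -(mule0 (3 ^+ d / c)%:E); apply: cvgeZl => //; exact: tail_mass_cvg0.
apply: (cvge_to_ge cv); apply: nearW => K; have [mVK _] := HV K; apply: le_trans.
by apply: le_measure; rewrite ?inE//; exact: bigcap_inf.
Qed.

Definition below (p : int * 'rV[int]_d) (o : I) : Prop :=
  if o is Some (m, l) then m <= p.1 /\ cube p.1 p.2 `<=` cube m l else False.

(* The cover [q] has content less than that of a good cube in it and does not
   swallow it, so a nested sequence of good cubes shrinks to an uncovered point. *)
Definition good t (q : nat -> I) (p : int * 'rV[int]_d) :=
  (tail_mass t q 0 (cube p.1 p.2) < (side p.1 `^ t)%:E)%E /\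
  forall i, ~ below p (q i).

Lemma not_below p o m l x : o = Some (m, l) -> ~ below p o ->
  cube p.1 p.2 x -> cube m l x -> p.1 < m /\ cube m l `<=` cube p.1 p.2.
Proof.
move=> -> /= nb px mx; have [mp|pm] := leP m p.1.
  by exfalso; apply: nb; split => //; exact: dyadic_cube_sub mp mx px.
by split=> //; exact: dyadic_cube_sub (ltW pm) px mx.
Qed.

Lemma side_powR_ge (n : int) t : 0 <= n -> t <= d%:R -> side n ^+ d <= side n `^ t :> R.
Proof.
move=> n0 td; rewrite -powR_mulrn ?(ltW (side_gt0 _))//.
by rewrite ger_powR// side_gt0 side_le1.
Qed.

(** No cube of the cover contains an uncovered point's cube, so goodness can fail only through too
    large a mass, and side^t >= side^d. Beyond the levels of the first K cubes, these miss the small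
    cube and its mass comes from the tail. *)
Lemma small_cube_tail t q K z : t <= d%:R -> (forall i, ~ ocube (q i) z) ->
  exists N : nat, forall n : nat, (N <= n)%N -> ~ good t q (n%:Z, idx n z) ->
    ((1 * side n ^+ d)%:E <= tail_mass t q K (cube n (idx n z)))%E.
Proof.
move=> td zq.
exists (\max_(i < K) (if q i is Some (m, _) then `|m|%N else 0%N)).
move=> n Nn ng; rewrite mul1r -(@tail_mass_eq _ _ K); last first.
  move=> i iK; apply/seteqP; split=> // y [].
  have := zq i; have := leq_trans (@leq_bigmax_cond _ xpredT (fun i : 'I_K =>
    if q i is Some (m, _) then `|m|%N else 0%N) (Ordinal iK) isT) Nn.
  rewrite /=; case: (q i) => [[m l]|]//= mn zm ym yz; apply: zm.
  rewrite !dyadic_cubeE /= in ym yz *; rewrite -ym; apply: (idx_coarse _ (esym yz)).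
  lia.
rewrite leNgt; apply/negP => h; apply: ng; split => /=.
  by apply: lt_le_trans h _; rewrite lee_fin side_powR_ge.
move=> i; have := zq i; case: (q i) => [[m l]|]//= zm [_ ]; apply: contra_not zm.
by apply; exact: dyadic_cube_idx.
Qed.

Lemma negligible_not_good t q (S : set 'rV[R]_d) : t <= d%:R ->
  (tail_mass t q 0 setT < +oo)%E -> (forall i z, S z -> ~ ocube (q i) z) ->
  (forall z, S z -> exists N : nat, forall n : nat, (N <= n)%N -> ~ good t q (n%:Z, idx n z)) ->
  lam.-negligible S.
Proof.
move=> td qoo Sq Sg; apply: (@negligible_of_tails t q 0 1) => // K z Sz.
have [N Nz] := Sg z Sz.
have [N' N'z] := @small_cube_tail t q K z td (fun i => @Sq i z Sz).
exists (maxn N N')%:Z, (idx (maxn N N') z); split => //.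
  exact: sub_nbr (dyadic_cube_idx _ _).
by apply: N'z; [exact: leq_maxr|apply: Nz; exact: leq_maxl].
Qed.

(** Each cube of the cover that meets a good cube is a smaller cube inside it, so its volume
    side_m^d is at most side_n^(d-t) side_m^t. Summing, the covered part has volume less than
    side_n^d. *)
Lemma good_not_covered t q n k : t <= d%:R -> good t q (n, k) ->
  (0 < lam (cube n k `\` \bigcup_i ocube (q i)))%E.
Proof.
move=> td [qn nb]; rewrite lt0e measure_ge0 andbT; apply/eqP => l0.
have mq : measurable (\bigcup_i ocube (q i)).
  by apply: bigcupT_measurable => i; exact: measurable_ocube.
have mc := measurable_cube (R:=R) n k.
suff : (lam (cube n k) < (side n ^+ d)%:E)%E by rewrite lebesgue_cube ltxx.
have s0 : 0 < side n `^ (d%:R - t) :> R by rewrite powR_gt0 ?side_gt0.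
apply: (@le_lt_trans _ _ ((side n `^ (d%:R - t))%:E * tail_mass t q 0 (cube n k))%E); last first.
  have -> : side n ^+ d = side n `^ (d%:R - t) * side n `^ t :> R.
    by rewrite -powRD ?subrK ?powR_mulrn ?(ltW (side_gt0 _))// side_neq0 implybT.
  by rewrite EFinM lte_pmul2l// lte_fin.
rewrite -[cube n k in leLHS](setDUK (@subIsetl _ (cube n k) (\bigcup_i ocube (q i)))).
rewrite setUC setDIr setDv set0U measureU//; last 3 first.
- exact: measurableD.
- exact: measurableI.
- by apply/seteqP; split=> x // -[[_ +] [_ ]].
rewrite [X in (X + _)%E]l0 add0e setI_bigcupr tail_massE -nneseriesZl//.
apply: (@le_trans _ _ (\sum_(i <oo) lam (cube n k `&` ocube (q i)))%E).
  apply: generalized_Boole_inequality => [i|].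
    by apply: measurableI => //; exact: measurable_ocube.
  apply: bigcupT_measurable => i.
  by apply: measurableI => //; exact: measurable_ocube.
apply: lee_nneseries => // i _.
have [->|/set0P[x [nx qx]]] := eqVneq (cube n k `&` ocube (q i)) set0.
  by rewrite measure0 mule_ge0// lee_fin ltW.
case qi : (q i) qx (nb i) => [[m l]|]// mx nbi.
have [/= nm mn] := not_below erefl nbi nx mx.
rewrite setIidr// lebesgue_cube corner_mass_in; last first.
  by rewrite qi; apply: mn; exact: dyadic_cube_corner.
rewrite qi -EFinM lee_fin /=.
have -> : side m ^+ d = side m `^ (d%:R - t) * side m `^ t :> R.
  by rewrite -powRD ?subrK ?powR_mulrn ?(ltW (side_gt0 _))// side_neq0 implybT.
rewrite ler_wpM2r ?powR_ge0// ge0_ler_powR ?nnegrE ?subr_ge0 ?(ltW (side_gt0 _))//.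
by apply: le_side; exact: ltW.
Qed.

End cube_measures.

(** * Energy estimates on cubes, and lifts of small balls *)

Section energy_on_cubes.
Context {R : realType} {d : nat}.
Local Notation I := (option (int * 'rV[int]_d)).
Implicit Types (x y z : 'rV[R]_d) (k : 'rV[int]_d) (t : R).
Local Notation pi := (@torus_pi R d).
Local Notation lam := (@lebesgue_row R d).
Local Notation cube := (@dyadic_cube R d).
Local Notation ocube := (@ocube R d).

Lemma cube_euclid_dist (n : int) k x y : cube n k x -> cube n k y ->
  euclid_dist x y <= Num.sqrt d%:R * side n.
Proof.
rewrite dyadic_cubeE /= => <- yx; apply: euclid_dist_le_coord.
  exact: ltW (side_gt0 _).
move=> i; apply/ltW/dfloor_eq_dist.
by move/rowP: yx => /(_ i); rewrite !mxE => ->.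
Qed.

Lemma measurable_lift (U : set (torus R d)) : open U -> measurable (pi @^-1` U).
Proof. by move=> oU; apply: measurable_open; exact: oU. Qed.

(** A bound for the diameter of the cube. The value 1 at [None] keeps it positive, as the weights in
    Cauchy-Schwarz must be. *)
Definition oside (o : I) : R :=
  Num.sqrt d%:R * (if o is Some (m, _) then side m else 1).

Lemma oside_gt0 o : (0 < d)%N -> 0 < oside o.
Proof.
by move=> d_gt0; rewrite mulr_gt0 ?sqrtr_gt0 ?ltr0n//; case: o => [[m l]|]//=; exact: side_gt0.
Qed.

Lemma sum_cube_weight_le_tail_mass t (q : nat -> I) (M : nat) (A : set 'rV[R]_d) (P : pred nat) :
  (forall i, P i -> A (ocorner (q i))) ->
  ((\sum_(i < M | P i) cube_weight t (q i))%:E <= tail_mass t q 0 A)%E.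
Proof.
move=> PA; rewrite tail_massE.
apply: le_trans (@nneseries_lim_ge _ _ _ _ M _) => //.
rewrite -sumEFin big_mkord big_mkcond/=; apply: lee_sum => i _.
by case: ifPn => // /PA Aq; rewrite (@corner_mass_in _ _ t q i A Aq).
Qed.

(** The blocks are the parts of U in the successive cover cubes, made disjoint; they exhaust U in
    the cube up to a null set. *)
Lemma sqr_lebesgue_cube_le_energy (t tt : R) (q : nat -> I) (U : set (torus R d))
    (n : int) k :
  (0 < d)%N -> 0 < t -> t <= tt -> open U -> 0 <= n -> cube n k `<=` @unit_cube R d ->
  (forall i, ~ below (R:=R) (n, k) (q i)) ->
  (riesz_energy tt U < +oo)%E -> (tail_mass t q 0 setT < +oo)%E ->
  lam (pi @^-1` U `&` cube n k `\` \bigcup_i ocube (q i)) = 0%E ->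
  (lam (pi @^-1` U `&` cube n k) ^+ 2 <=
   riesz_energy tt U * ((Num.sqrt d%:R `^ tt)%:E * tail_mass t q 0 (cube n k)))%E.
Proof.
move=> d_gt0 t0 ttt oU n0 Q01 nb rfin qfin V0.
set V := pi @^-1` U `&` cube n k in V0 *.
have mV : measurable V by apply: measurableI; [exact: measurable_lift|exact: measurable_cube].
have mq i : measurable (ocube (q i)) := measurable_ocube _.
pose D := seqDU (fun i => ocube (q i)).
have mD i : measurable (D i).
  by apply: measurableD => //; apply: bigsetU_measurable.
pose A i := V `&` D i.
have mA i : measurable (A i) by exact: measurableI.
have tA : trivIset setT A by apply: trivIset_setIl; exact: trivIset_seqDU.
have lamV : (lam V = \sum_(i <oo) lam (A i))%E.
  rewrite -measure_semi_bigcup//; last exact: bigcupT_measurable.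
  rewrite -setI_bigcupr -seqDU_bigcup_eq.
  rewrite -[V in LHS](setDUK (@subIsetl _ V (\bigcup_i ocube (q i)))).
  rewrite setDIr setDv set0U measureU; first by rewrite [X in (_ + X)%E]V0 adde0.
  - by apply: measurableI => //; exact: bigcupT_measurable.
  - by apply: measurableD => //; exact: bigcupT_measurable.
  - by apply/seteqP; split=> x // -[[_ +] [_ ]].
have tmfin : (tail_mass t q 0 (cube n k) < +oo)%E.
  apply: le_lt_trans qfin; apply: le_measure; rewrite ?inE//; exact: measurable_cube.
have r0 : (0 <= riesz_energy tt U)%E.
  apply: integral_ge0 => x _; apply: integral_ge0 => y _.
  by rewrite inve_ge0 lee_fin powR_ge0.
have fr : riesz_energy tt U \is a fin_num by rewrite ge0_fin_numE.
have ft : tail_mass t q 0 (cube n k) \is a fin_num by rewrite ge0_fin_numE.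
rewrite -(fineK fr) -(fineK ft) -!EFinM.
set Y := fine _ * _.
have Y0 : 0 <= Y by rewrite !mulr_ge0 ?fine_ge0 ?powR_ge0.
(* Taking the square root first leaves a bound on a series, which can be checked on its partial
   sums. *)
suff : (lam V <= (Num.sqrt Y)%:E)%E.
  move=> VY; rewrite -[leRHS](_ : ((Num.sqrt Y)%:E ^+ 2 = Y%:E)%E); last first.
    by rewrite -EFin_expe sqr_sqrtr.
  by rewrite !expe2 lee_pmul.
rewrite lamV; apply: lime_le; first exact: is_cvg_nneseries.
apply: nearW => M /=.
(* Only the cover cubes meeting the given cube contribute a block. They lie inside it, so their
   corners are counted by its tail mass. *)
pose P (i : nat) := `[< ocube (q i) `&` cube n k !=set0 >].
have A0 i : ~~ P i -> A i = set0.
  move=> /asboolP nqk; rewrite /A /D /seqDU; apply/seteqP; split=> x // -[[_ kx] [qx _]].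
  by apply: nqk; exists x.
have Pin i : P i -> cube n k (ocorner (q i)) /\
    exists m l, q i = Some (m, l) /\ 0 <= m.
  move=> /asboolP[x []]; have := nb i; case: (q i) => [[m l]|]// nbi mx nx.
  have [/= nm mn] := not_below erefl nbi nx mx; split.
    by apply: mn; exact: dyadic_cube_corner.
  by exists m, l; split => //; exact: le_trans n0 (ltW nm).
rewrite big_mkord (bigID (fun i : 'I_M => P i))/= [X in (_ + X)%E]big1 ?adde0; last first.
  by move=> i /A0 ->; rewrite measure0.
have mU : measurable U by apply/measurable_torusE; exact: measurable_lift.
have tA' : trivIset setT (fun i : 'I_M => A i).
  by move=> i j _ _ ij; apply/val_inj; exact: tA ij.
have := @sqr_lebesgue_le_riesz_energy R d tt U 'I_M (fun i => P i) (fun i => A i)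
  (fun i => oside (q i)) (lt_le_trans t0 ttt) mU (fun i => mA i)
  (fun i x Aix => conj Aix.1.1 (Q01 _ Aix.1.2)) tA' (fun i => oside_gt0 (q i) d_gt0).
set s := (\sum_(i < M | P i) _)%E => /(_ _)/wrap[].
  move=> i x y [_ [+ _]] [_ [+ _]]; rewrite /oside; case: (q i) => [[m l]|]//=.
  exact: cube_euclid_dist.
move=> sE.
have sfin : s \is a fin_num.
  apply/sum_fin_numP => i _ _; rewrite ge0_fin_numE//.
  apply: (@le_lt_trans _ _ (lam (cube n k))); last by rewrite lebesgue_cube ltry.
  by apply: le_measure; rewrite ?inE//; [exact: measurable_cube|move=> x [[_ ]]].
have s0 : (0 <= s)%E by apply: sume_ge0.
have : (s ^+ 2 <= Y%:E)%E.
  apply: (le_trans sE); rewrite /Y EFinM fineK// lee_wpmul2l//.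
  rewrite EFinM fineK//.
  (* Here the exponent drops from [tt] to [t], the cubes involved having side at most 1. *)
  apply: (@le_trans _ _ ((Num.sqrt d%:R `^ tt)%:E * (\sum_(i < M | P i) cube_weight t (q i))%:E)%E).
    rewrite -EFinM lee_fin mulr_sumr; apply: ler_sum => i /Pin[_ [m [l [qi m0]]]].
    rewrite qi /= powRM ?sqrtr_ge0 ?(ltW (side_gt0 _))//.
    by rewrite ler_wpM2l ?powR_ge0// ger_powR// side_gt0 side_le1.
  rewrite lee_wpmul2l ?lee_fin ?powR_ge0//.
  by apply: sum_cube_weight_le_tail_mass => i /Pin[].
rewrite -(fineK sfin) -EFin_expe !lee_fin => sY.
by rewrite -[leLHS](ger0_norm (fine_ge0 s0)) -sqrtr_sqr ler_wsqrtr.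
Qed.

(* The digits 0, 1, 2 encode the displacements -1, 0, 1. *)
Definition nbr_index k (e : {ffun 'I_d -> 'I_3}) : 'rV[int]_d :=
  \row_i (k ord0 i + (e i)%:Z - 1).

Lemma nbr_bigcup (n : int) k :
  nbr n k = \bigcup_(e : {ffun 'I_d -> 'I_3}) cube n (nbr_index k e).
Proof.
apply/seteqP; split=> x.
  move=> xk; pose f i := absz (idx n x ord0 i - k ord0 i + 1).
  have f3 i : (f i < 3)%N by rewrite /f; have := xk i; lia.
  exists [ffun i => Ordinal (f3 i)] => //; rewrite dyadic_cubeE /=.
  apply/rowP => i; rewrite [RHS]mxE ffunE /= /f; move: (xk i); rewrite !ord1; lia.
move=> [e _]; rewrite dyadic_cubeE /= => xe i; rewrite xe mxE; have := ltn_ord (e i); lia.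
Qed.

Lemma nbr_index_near k e i : `|k ord0 i - nbr_index k e ord0 i| <= 1.
Proof. rewrite mxE; have := ltn_ord (e i); lia. Qed.

(** A ball can straddle dyadic faces of every level, whereas content is counted on single cubes;
    this selects one cube at the price of a constant. *)
Lemma nbr_pigeonhole (n : int) k (V : set 'rV[R]_d) : measurable V ->
  V `<=` nbr n k -> exists e,
  (lam V <= (3 ^+ d)%:E * lam (V `&` cube n (nbr_index k e)))%E.
Proof.
pose T : finType := {ffun 'I_d -> 'I_3}; move=> mV Vk.
have T3 : (3 ^+ d = #|T|%:R :> R) by rewrite card_ffun !card_ord natrX.
rewrite T3.
have mVe e : measurable (V `&` cube n (nbr_index k e)).
  by apply: measurableI => //; exact: measurable_cube.
have fV e : lam (V `&` cube n (nbr_index k e)) \is a fin_num.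
  rewrite ge0_fin_numE//; apply: (@le_lt_trans _ _ (lam (cube n (nbr_index k e)))).
    by apply: le_measure; rewrite ?inE//; exact: measurable_cube.
  by rewrite lebesgue_cube ltry.
pose e0 : T := [ffun=> ord0].
pose B i := V `&` cube n (nbr_index k (nth e0 (enum T) i)).
have VB : (lam V <= \sum_(i < #|T|) lam (B i))%E.
  apply: content_subadditive => //; first by move=> i _; exact: mVe.
  rewrite -bigcup_mkord => x Vx; have := Vk _ Vx; rewrite nbr_bigcup => -[e _ xe].
  exists (index e (enum T)); first by rewrite /= cardE index_mem mem_enum.
  by split => //; rewrite nth_index ?mem_enum.
apply: contrapT => /forallNP h.
have T0 : (0 < #|T|)%N by apply/card_gt0P; exists e0.
have T0' : 0 < #|T|%:R :> R by rewrite ltr0n.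
have fB : lam V \is a fin_num.
  rewrite ge0_fin_numE//; apply: le_lt_trans VB _; apply/lte_sum_pinfty => i _.
  by have := fV (nth e0 (enum T) i); rewrite ge0_fin_numE.
move: VB; apply/negP; rewrite -ltNge -(fineK fB).
rewrite (eq_bigr (fun i : 'I_#|T| => (fine (lam (B i)))%:E)); last first.
  by move=> i _; rewrite fineK//; exact: fV.
rewrite sumEFin lte_fin.
have -> : fine (lam V) = \sum_(i < #|T|) (fine (lam V) / #|T|%:R).
  by rewrite sumr_const card_ord -[RHS]mulr_natr mulfVK// gt_eqF.
apply: ltr_sum; first by apply/hasP; exists (Ordinal T0) => //; exact: mem_index_enum.
move=> i _; rewrite ltr_pdivlMr// mulrC -lte_fin EFinM !fineK//; last exact: fV.
by have /negP := h (nth e0 (enum T) i); rewrite -ltNge.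
Qed.

(** A refinement by d levels thus absorbs the factor sqrt d in the diameter of a cube. *)
Lemma sqrt_le_exp2 : Num.sqrt d%:R <= 2 ^+ d :> R.
Proof.
rewrite -[leRHS]ger0_norm ?exprn_ge0// -sqrtr_sqr; apply: ler_wsqrtr.
apply: (@le_trans _ _ (2 ^+ d)); first by rewrite -natrX ler_nat ltnW// ltn_expl.
by rewrite expr2 ler_peMl ?exprn_ge0// exprn_ege1// ler1n.
Qed.

Lemma torus_ball_center_lift (x : torus R d) z r : torus_ball x r (pi z) ->
  exists2 a, pi a = x & euclid_dist a z < r.
Proof.
have [a <-] := torus_pi_surj x; move=> /torus_dist_lift[b /eqP/torus_piP[k bz] abr].
exists (a - map_mx intr k); first by rewrite -map_mxN torus_pi_shift.
move: abr; rewrite /euclid_dist; congr (euclid_norm _ < _).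
by rewrite -bz opprB addrAC addrA subrK.
Qed.

(** No wrap-around: a point of the lifted ball has a translate within 2r of z. That translate lies
    in the unit cube, so it is the point itself. *)
Lemma lift_sub_box (x : torus R d) z r (e : R) : torus_ball x r (pi z) ->
  2 * r <= e -> box z e `<=` @unit_cube R d ->
  pi @^-1` torus_ball x r `&` @unit_cube R d `<=` box z (2 * r).
Proof.
move=> /torus_ball_center_lift[a <- az] re z01 y [/torus_dist_lift[y' y'y ay'] y01].
have y'z : box z (2 * r) y'.
  move=> i; rewrite mulrDl !mul1r; apply: le_lt_trans (ler_distD (a ord0 i) _ _) _.
  rewrite ltrD//; last exact: le_lt_trans (euclid_dist_ge_coord _ _ _) az.
  by rewrite distrC; exact: le_lt_trans (euclid_dist_ge_coord _ _ _) ay'.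
rewrite -(torus_pi_unit_inj _ y01 y'y)//; apply: z01 => i.
exact: lt_le_trans (y'z i) re.
Qed.

(** The ball contains the cube of level n + 3 + d around its centre: d levels offset sqrt d and 3
    levels give the factor 1/8, so the diameter is at most side_n / 8 < r. *)
Lemma torus_ball_volume (x : torus R d) z r (e : R) (n : nat) : torus_ball x r (pi z) ->
  2 * r <= e -> box z e `<=` @unit_cube R d -> side n < 8 * r ->
  ((side (3 + d)%N ^+ d * side n ^+ d)%:E <= torus_lebesgue (torus_ball x r))%E.
Proof.
move=> /torus_ball_center_lift[a <- az] re z01 nr.
pose m := (n + (3 + d))%N.
rewrite mulrC -exprMn -sideD -PoszD -(lebesgue_cube m (idx m a)) torus_lebesgueE.
have mr : Num.sqrt d%:R * side m < r.
  apply: (@le_lt_trans _ _ (2 ^+ d * side m)).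
    by rewrite ler_wpM2r ?sqrt_le_exp2// ltW// side_gt0.
  have sd : side d = (2 ^+ d)^-1 :> R by rewrite /side -invr_expz -exprnP.
  have s3 : side 3 = 8^-1 :> R by rewrite /side -invr_expz -exprnP; congr (_^-1); ring.
  rewrite /m !PoszD !sideD sd s3.
  have p0 : 2 ^+ d != 0 :> R by rewrite gt_eqF ?exprn_gt0.
  have -> : 2 ^+ d * (side n * (8^-1 * (2 ^+ d)^-1)) = side n / 8 :> R by field.
  by rewrite ltr_pdivrMr// mulrC.
have aB y : cube m (idx m a) y -> euclid_dist a y < r.
  move=> ay; apply: le_lt_trans mr.
  by apply: cube_euclid_dist ay; exact: dyadic_cube_idx.
apply: le_measure; rewrite ?inE.
- exact: measurable_cube.
- by apply: measurableI; [apply: measurable_lift; exact: torus_ball_open|exact: measurable_unit_cube].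
- move=> y /aB ay; split; first exact: le_lt_trans (torus_dist_le _ _) ay.
  apply: z01 => i; apply: lt_le_trans re; rewrite mulrDl !mul1r.
  apply: le_lt_trans (ler_distD (a ord0 i) _ _) _.
  rewrite ltrD//; last exact: le_lt_trans (euclid_dist_ge_coord _ _ _) az.
  by rewrite distrC; exact: le_lt_trans (euclid_dist_ge_coord _ _ _) ay.
Qed.

End energy_on_cubes.

(** * Balls of the limsup set *)

Section balls.
Context {R : realType} {d : nat}.
Hypothesis d_gt0 : (0 < d)%N.
Local Notation I := (option (int * 'rV[int]_d)).
Implicit Types (x y z : 'rV[R]_d) (k : 'rV[int]_d) (t : R).
Local Notation pi := (@torus_pi R d).
Local Notation lam := (@lebesgue_row R d).
Local Notation cube := (@dyadic_cube R d).
Local Notation ocube := (@ocube R d).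

(** The ratio of the theorem in cross-multiplied form, free of quotients of extended reals. *)
Definition energy_bound (tt C : R) (x : torus R d) (r : R) (U : set (torus R d)) :=
  (riesz_energy tt U * torus_lebesgue (torus_ball x r) <=
   C%:E * torus_lebesgue U ^+ 2)%E.

(* Combines the volume ratio of the ball and a comparable dyadic cube, the
   pigeonhole loss 3 ^ d (squared by Cauchy-Schwarz) and the energy bound C; the
   minimum with 1 covers the case where the cube is contained in one of [q]. *)
Definition heavy_const (tt C : R) : R := Num.min 1
  (side (3 + d)%N ^+ d / ((3 ^+ d) ^+ 2 * (Num.sqrt d%:R `^ tt) * C)).

Lemma heavy_const_gt0 tt C : 0 < C -> 0 < heavy_const tt C.
Proof.
move=> C0; rewrite /heavy_const lt_min ltr01/= divr_gt0 ?exprn_gt0 ?side_gt0//.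
by rewrite !mulr_gt0 ?exprn_gt0// powR_gt0// sqrtr_gt0 ltr0n.
Qed.

(** The ball has positive measure, so an infinite energy would make the left side of the bound
    infinite. *)
Lemma energy_bound_fin tt C (x : torus R d) r (U : set (torus R d)) : open U -> 0 < r ->
  energy_bound tt C x r U -> (riesz_energy tt U < +oo)%E.
Proof.
move=> oU r0 ebd; rewrite ltey; apply/eqP => Uoo.
have mB : measurable (torus_ball x r).
  by apply/measurable_torusE; apply: measurable_lift; exact: torus_ball_open.
have mU : measurable U by apply/measurable_torusE; exact: measurable_lift.
have B0 : (0 < torus_lebesgue (torus_ball x r))%E.
  apply: torus_lebesgue_open_gt0; first exact: torus_ball_open.
  have [a <-] := torus_pi_surj x; exists (pi a).
  apply: le_lt_trans (torus_dist_le a a) _.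
  rewrite /euclid_dist subrr /euclid_norm big1 ?sqrtr0// => i _.
  by rewrite mxE expr0n.
move: ebd; rewrite /energy_bound Uoo gt0_mulye// -(fineK (torus_lebesgue_fin mU)).
by rewrite -EFin_expe -EFinM leye_eq.
Qed.

(* If [q] covers U almost everywhere, the energy bound forces [q] to have content
   of the order of the volume of the ball in a cube of comparable size. *)
Lemma heavy_cube_near_ball_point (t tt C : R) (q : nat -> I) (U : set (torus R d)) (x : torus R d)
    (r e : R) (n0 : int) k0 z (K : nat) :
  0 < t -> t <= tt -> t <= d%:R -> 0 < C ->
  open U -> U !=set0 -> U `<=` torus_ball x r -> 0 < r ->
  energy_bound tt C x r U ->
  0 <= n0 -> cube n0 k0 `<=` @unit_cube R d ->
  (forall i, ~ below (R:=R) (n0, k0) (q i)) -> (tail_mass t q 0 setT < +oo)%E ->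
  lam (pi @^-1` U `&` cube n0 k0 `\` \bigcup_i ocube (q i)) = 0%E ->
  box z e `<=` cube n0 k0 -> (forall i, (i < K)%N -> ocube (q i) `&` box z e = set0) ->
  16 * r <= e -> 4 * r < 1 -> torus_ball x r (pi z) ->
  exists (n : int) k, [/\ 0 <= n, nbr n k z &
    ((heavy_const tt C * side n ^+ d)%:E <= tail_mass t q K (cube n k))%E].
Proof.
move=> t0 ttt td C0 oU U0 UB r0 ebd n00 p01 nb qfin V0 zp zq re r1 Bz.
have r40 : 0 < 4 * r by lra.
(* With 4r <= side n < 8r, the box of radius 2r around z lies in [nbr n (idx n z)], and by 16r <= e
   this lies in [box z e]. *)
have [n /andP[rn nr]] := exists_side_bracket r40 r1.
have z01 : box z e `<=` @unit_cube R d by exact: subset_trans p01.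
set Uh := pi @^-1` U `&` @unit_cube R d.
have Uhz : Uh `<=` box z (2 * r).
  move=> y [Uy y01]; apply: (lift_sub_box Bz (e := e)) => //; first lra.
  by split => //; exact: UB.
have mU : measurable U by apply/measurable_torusE; exact: measurable_lift.
have mUh : measurable Uh.
  by apply: measurableI; [exact: measurable_lift|exact: measurable_unit_cube].
have Uhn : Uh `<=` nbr n (idx n z).
  by apply: (subset_trans Uhz); apply: box_sub_nbr; lra.
have [e' Ue'] := nbr_pigeonhole mUh Uhn.
set l := nbr_index (idx n z) e' in Ue'.
have Qz : cube n l `<=` box z e.
  apply: (@subset_trans _ (nbr n (idx n z))).
    by rewrite nbr_bigcup => y yl; exists e'.
  by apply: nbr_sub_box; lra.
have zQ : nbr n l z by move=> i; exact: nbr_index_near.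
have UhQ : Uh `&` cube n l = pi @^-1` U `&` cube n l.
  by apply/seteqP; split=> y [] => [[Uy _ ?]|Uy Qy]; split => //; split => //; apply/z01/Qz.
rewrite UhQ in Ue'.
have corner_in : cube n l (corner n l) := dyadic_cube_corner n l.
(* If a cover cube swallows the selected cube, it is heavy by its own weight, and it belongs to the
   tail because the first K cubes avoid the box. Otherwise the energy estimate applies. *)
have [[i bi]|nbQ] := pselect (exists i, below (R:=R) (n%:Z, l) (q i)).
  have Ki : (K <= i)%N.
    rewrite leqNgt; apply/negP => iK; have := zq i iK; apply/eqP/set0P.
    exists (corner n l); split; last exact: Qz.
    by move: bi; case: (q i) => [[m l']|]//= [_]; apply.
  case qi : (q i) bi => [[m l']|]//= [mn Qm].
  have [/= n0m _] := not_below qi (nb i) (zp _ (Qz _ corner_in)) (Qm _ corner_in).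
  exists m, l'; split.
  - exact: le_trans n00 (ltW n0m).
  - exact: (nbr_sub mn Qm).
  - apply: (@le_trans _ _ (cube_weight t (q i))%:E); last first.
      by apply: tail_mass_ge => //; rewrite qi; exact: dyadic_cube_corner.
    rewrite lee_fin qi /=; apply: (@le_trans _ _ (side m ^+ d)).
      by rewrite ler_piMl ?exprn_ge0 ?(ltW (side_gt0 _))// /heavy_const ge_min lexx.
    by apply: side_powR_ge => //; exact: le_trans n00 (ltW n0m).
exists n, l; split => //.
have Vn0 : lam (pi @^-1` U `&` cube n l `\` \bigcup_i ocube (q i)) = 0%E.
  apply/eqP; rewrite eq_le measure_ge0 andbT -V0; apply: le_measure; rewrite ?inE.
  - apply: measurableD; last by apply: bigcupT_measurable => i; exact: measurable_ocube.
    by apply: measurableI; [exact: measurable_lift|exact: measurable_cube].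
  - apply: measurableD; last by apply: bigcupT_measurable => i; exact: measurable_ocube.
    by apply: measurableI; [exact: measurable_lift|exact: measurable_cube].
  - by move=> y [[Uy Qy] ny]; do 2!split => //; apply/zp/Qz.
have rfin := energy_bound_fin oU r0 ebd.
have := sqr_lebesgue_cube_le_energy d_gt0 t0 ttt oU (le0z_nat n)
  (subset_trans Qz z01) (fun i b => nbQ (ex_intro _ i b)) rfin qfin Vn0.
have -> : tail_mass t q 0 (cube n l) = tail_mass t q K (cube n l).
  apply: tail_mass_eq => i iK; apply/seteqP; split=> // y [qy Qy].
  by rewrite -(zq i iK); split => //; exact: Qz.
have Bvol : ((side (3 + d)%N ^+ d * side n ^+ d)%:E <= torus_lebesgue (torus_ball x r))%E.
  by apply: (torus_ball_volume (e := e) Bz) => //; lra.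
have U00 : (0 < lam Uh)%E by exact: torus_lebesgue_open_gt0.
move: ebd; rewrite /energy_bound [torus_lebesgue U]torus_lebesgueE -/Uh.
have mB : measurable (torus_ball x r).
  by apply/measurable_torusE; apply: measurable_lift; exact: torus_ball_open.
have fB := torus_lebesgue_fin mB.
have fU : lam Uh \is a fin_num := torus_lebesgue_fin mU.
have fR : riesz_energy tt U \is a fin_num.
  rewrite ge0_fin_numE//; apply: integral_ge0 => a _; apply: integral_ge0 => b _.
  by rewrite inve_ge0 lee_fin powR_ge0.
have fT : tail_mass t q K (cube n l) \is a fin_num.
  rewrite ge0_fin_numE//; apply: le_lt_trans qfin.
  rewrite -(@tail_mass_eq _ _ _ _ K); last first.
    move=> i iK; apply/seteqP; split=> // y [qy Qy].
    by rewrite -(zq i iK); split => //; exact: Qz.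
  by apply: le_measure; rewrite ?inE//; exact: measurable_cube.
have fQ : lam (pi @^-1` U `&` cube n l) \is a fin_num.
  rewrite ge0_fin_numE//; apply: (@le_lt_trans _ _ (lam (cube n l))).
    apply: le_measure; rewrite ?inE//; last exact: measurable_cube.
    by apply: measurableI; [exact: measurable_lift|exact: measurable_cube].
  by rewrite lebesgue_cube ltry.
move: Bvol Ue' U00; rewrite -(fineK fB) -(fineK fU) -(fineK fR) -(fineK fT) -(fineK fQ).
rewrite -!EFin_expe -!EFinM !lee_fin lte_fin.
set T := fine (tail_mass _ _ _ _); set B := fine (torus_lebesgue _).
set u := fine (lam Uh); set a := fine (lam _); set E := fine (riesz_energy _ _).
have B0 : 0 <= B by exact: fine_ge0.
have E0 : 0 <= E.
  apply: fine_ge0; apply: integral_ge0 => ? _; apply: integral_ge0 => ? _.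
  by rewrite inve_ge0 lee_fin powR_ge0.
have T0 : 0 <= T by exact: fine_ge0.
set g := Num.sqrt _ `^ _; have g0 : 0 < g by rewrite powR_gt0// sqrtr_gt0 ltr0n.
have p3 : 0 < 3 ^+ d :> R by rewrite exprn_gt0.
set s := side _ ^+ d; set sn := side n ^+ d => sB ua u0 EB aE.
have sn0 : 0 < sn by rewrite exprn_gt0 ?side_gt0.
apply: (@le_trans _ _ (s / ((3 ^+ d) ^+ 2 * g * C) * sn)).
  by rewrite ler_wpM2r ?(ltW sn0)// /heavy_const ge_min lexx orbT.
rewrite mulrAC ler_pdivrMr; last by rewrite !mulr_gt0 ?exprn_gt0.
(* The factor u^2 is introduced to bring in the pigeonhole bound u <= 3^d a, then the energy
   estimate for a^2; it reappears through the energy bound and cancels. *)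
apply: (le_trans sB); rewrite -(ler_pM2l (exprn_gt0 2 u0)).
apply: (@le_trans _ _ ((3 ^+ d * a) ^+ 2 * B)).
  by rewrite ler_wpM2r// ler_pXn2r// nnegrE ltW//; exact: lt_le_trans ua.
rewrite exprMn; apply: (@le_trans _ _ ((3 ^+ d) ^+ 2 * (E * (g * T) * B))).
  by rewrite -[leLHS]mulrA ler_wpM2l ?sqr_ge0// ler_wpM2r.
have -> : (3 ^+ d) ^+ 2 * (E * (g * T) * B) = ((3 ^+ d) ^+ 2 * g * T) * (E * B) by ring.
apply: (@le_trans _ _ (((3 ^+ d) ^+ 2 * g * T) * (C * u ^+ 2))).
  by rewrite ler_wpM2l// !mulr_ge0 ?sqr_ge0// ltW.
by rewrite le_eqVlt; apply/orP; left; apply/eqP; ring.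
Qed.

End balls.

(** * Nested good cubes *)

Section limsup.
Context {R : realType} {d : nat}.
Local Notation I := (option (int * 'rV[int]_d)).
Implicit Types (y z : 'rV[R]_d) (k : 'rV[int]_d).
Local Notation pi := (@torus_pi R d).
Local Notation lam := (@lebesgue_row R d).
Local Notation cube := (@dyadic_cube R d).
Local Notation ocube := (@ocube R d).

(** Finitely many cubes that do not contain a nondyadic point all miss some box around it. *)
Lemma box_avoid (q : nat -> I) (n0 : int) z (K : nat) : nondyadic z ->
  (forall i, ~ ocube (q i) z) -> exists e, [/\ 0 < e,
    box z e `<=` cube n0 (idx n0 z) &
    forall i, (i < K)%N -> ocube (q i) `&` box z e = set0].
Proof.
move=> ndz zq; elim: K => [|K [e [e0 ze eq_]]].
  have [e e0 ze] := idx_locally_const n0 ndz.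
  by exists e; split => // y /ze yz; rewrite dyadic_cubeE.
have [e' e'0 ze'] : exists2 e', 0 < e' & ocube (q K) `&` box z e' = set0.
  have := zq K; case: (q K) => [[m l]|] /= zK; last by exists 1 => //; rewrite set0I.
  have [e' e'0 ze'] := idx_locally_const m ndz; exists e' => //.
  apply/seteqP; split=> // y []; rewrite !dyadic_cubeE /= in zK * => yl /ze' yz.
  by apply: zK; rewrite -yz.
have sub e1 : Num.min e e' <= e1 -> box z (Num.min e e') `<=` box z e1.
  by move=> ee y yz i; exact: lt_le_trans (yz i) ee.
exists (Num.min e e'); split; first by rewrite lt_min e0.
- by apply: subset_trans ze; apply: sub; rewrite ge_min lexx.
- move=> i; rewrite ltnS leq_eqVlt => /predU1P[->|iK]; apply/seteqP; split=> // y [qy yz].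
    by rewrite -ze'; split => //; apply: sub yz; rewrite ge_min lexx orbT.
  by rewrite -(eq_ i iK); split => //; apply: sub yz; rewrite ge_min lexx.
Qed.

Context (t tt C : R) (x : nat -> torus R d) (r : nat -> R) (U : nat -> set (torus R d)).
Hypotheses (d_gt0 : (0 < d)%N) (t_gt0 : 0 < t) (t_tt : t <= tt) (t_d : t <= d%:R)
  (C_gt0 : 0 < C) (r_gt0 : forall j, 0 < r j) (r_cvg0 : r @ \oo --> (0 : R))
  (U_neq0 : forall j, U j !=set0) (U_open : forall j, open (U j))
  (U_sub : forall j, U j `<=` torus_ball (x j) (r j))
  (E_full : torus_lebesgue
     (~` lim_sup_set (fun j => torus_ball (x j) (r j))) = 0%E)
  (U_energy : forall j, energy_bound tt C (x j) (r j) (U j)).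

Lemma measurable_limsup_balls :
  measurable (lim_sup_set (fun j => torus_ball (x j) (r j))).
Proof.
apply: bigcapT_measurable => n; apply: bigcup_measurable => j _.
by apply/measurable_torusE; apply: measurable_lift; exact: torus_ball_open.
Qed.

Lemma good_step (q : nat -> I) (n0 : int) k0 (j0 : nat) :
  0 <= n0 -> cube n0 k0 `<=` @unit_cube R d -> (tail_mass t q 0 setT < +oo)%E ->
  good t q (n0, k0) -> exists j n k, [/\ (j0 <= j)%N, n0 < n, good t q (n, k) &
    nbr n k `<=` cube n0 k0 `&` pi @^-1` U j].
Proof.
move=> n00 p01 qfin gp; apply: contrapT => H.
have {}H j n k : (j0 <= j)%N -> n0 < n -> nbr n k `<=` cube n0 k0 `&` pi @^-1` U j ->
    ~ good t q (n, k).
  by move=> jj nn sub g; case: H; exists j, n, k.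
have mp : measurable (cube n0 k0) := measurable_cube _ _.
have mq : measurable (\bigcup_i ocube (q i)).
  by apply: bigcupT_measurable => i; exact: measurable_ocube.
(* At a nondyadic uncovered point of U_j in the cube, the [nbr] of every small cube fits inside both
   sets, so no small cube there is good. *)
have V0 j : (j0 <= j)%N ->
    lam (pi @^-1` U j `&` cube n0 k0 `\` \bigcup_i ocube (q i)) = 0%E.
  move=> jj; apply: measure_negligible.
    by apply: measurableD => //; apply: measurableI => //; exact: measurable_lift.
  apply: (@negligibleS _ _ _ _ ((pi @^-1` U j `&` cube n0 k0 `\` \bigcup_i ocube (q i))
      `&` @nondyadic R d `|` (cube n0 k0 `&` ~` @nondyadic R d))).
    move=> z [[Uz pz] nz]; have [ndz|ndz] := pselect (nondyadic z); first by left.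
    by right.
  apply: negligibleU; last exact: negligible_dyadic_boundary.
  apply: (negligible_not_good t_d qfin).
    by move=> i z [[_ nz] _] qz; apply: nz; exists i.
  move=> z [[[Uz pz] nz] ndz].
  have [e e0 ze] := idx_locally_const n0 ndz.
  have oU : open (pi @^-1` U j) := @U_open j.
  have [e' e'0 ze'] := open_box oU Uz.
  have e20 : 0 < Num.min e e' / 2 by rewrite divr_gt0// lt_min e0.
  have [N Ne] := exists_side_lt e20.
  exists (maxn N (absz n0).+1) => n Nn; apply: (H j) => //; first lia.
  have nN : side n <= side N :> R by apply: le_side; lia.
  have nz2 : nbr n (idx n z) `<=` box z (Num.min e e').
    by apply: nbr_sub_box; move: Ne nN; rewrite ltr_pdivlMr//; lra.
  move=> y /nz2 yz; split.
    move: pz; rewrite dyadic_cubeE /= => <-; apply: ze => i.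
    by apply: lt_le_trans (yz i) _; rewrite ge_min lexx.
  by apply: ze' => i; apply: lt_le_trans (yz i) _; rewrite ge_min lexx orbT.
have := good_not_covered t_d gp; rewrite lt0e => /andP[/eqP + _]; apply.
apply: measure_negligible; first exact: measurableD.
pose L := lim_sup_set (fun j => torus_ball (x j) (r j)).
have negL : lam.-negligible (pi @^-1` (~` L) `&` @unit_cube R d).
  exists (pi @^-1` (~` L) `&` @unit_cube R d); split => //.
  apply: measurableI; last exact: measurable_unit_cube.
  apply/measurable_torusE; apply: measurableC; exact: measurable_limsup_balls.
apply: (@negligibleS _ _ _ _ ((cube n0 k0 `&` pi @^-1` L `&` @nondyadic R d `\`
    \bigcup_i ocube (q i)) `|` ((cube n0 k0 `&` ~` @nondyadic R d) `|`
    (pi @^-1` (~` L) `&` @unit_cube R d)))).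
  move=> z [pz nz]; have [ndz|ndz] := pselect (nondyadic z); last by right; left.
  have [Lz|Lz] := pselect (L (pi z)); first by left.
  by right; right; split => //; exact: p01.
apply: negligibleU; last by apply: negligibleU => //; exact: negligible_dyadic_boundary.
have c0 : 0 < heavy_const (d := d) tt C by apply: heavy_const_gt0.
apply: (@negligible_of_tails R d t q 0 _ _ c0 qfin) => K z.
move=> [[[pz Lz] ndz] nz].
have zq i : ~ ocube (q i) z by move=> qz; apply: nz; exists i.
have [e [e0 ze zqe]] := box_avoid n0 K ndz zq.
(* These are the two smallness conditions on the radius in [heavy_cube_near_ball_point]. *)
have e40 : 0 < Num.min (e / 16) (1 / 4) by rewrite lt_min !divr_gt0.
have [J _ rJ] := cvgr0_norm_lt r r_cvg0 _ e40.
have [j /= jJ Bz] := Lz (maxn j0 J) Logic.I.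
have rj := rJ j (leq_trans (leq_maxr _ _) jJ).
have jj : (j0 <= j)%N := leq_trans (leq_maxl _ _) jJ.
move: rj; rewrite /= ger0_norm ?(ltW (r_gt0 j))// lt_min => /andP[rj1 rj2].
move: ze; rewrite (_ : idx n0 z = k0); last by move: pz; rewrite dyadic_cubeE.
move=> ze; case: gp => _ nb.
apply: (heavy_cube_near_ball_point d_gt0 t_gt0 t_tt t_d C_gt0 (@U_open j) (U_neq0 j) (@U_sub j) (r_gt0 j)
  (U_energy j) n00 p01 nb qfin (V0 j jj) ze zqe _ _ Bz); lra.
Qed.

(** The lower corners increase in each coordinate. Their supremum can fall on the excluded upper
    face of a half-open cube, so it is located only in [nbr]. *)
Lemma nested_cubes_point (f : nat -> int * 'rV[int]_d) :
  (forall i, cube (f i.+1).1 (f i.+1).2 `<=` cube (f i).1 (f i).2) ->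
  exists y, forall i, nbr (f i).1 (f i).2 y.
Proof.
move=> fS.
have fM i j : (i <= j)%N -> cube (f j).1 (f j).2 `<=` cube (f i).1 (f i).2.
  move=> ij; rewrite -(subnKC ij); elim: (j - i)%N => [|m IH]; first by rewrite addn0.
  by rewrite addnS; exact: subset_trans (fS _) IH.
pose a i : 'rV[R]_d := corner (f i).1 (f i).2.
have aE i l : a i ord0 l = ((f i).2 ord0 l)%:~R * side (f i).1 by rewrite mxE.
have acube i j l : (i <= j)%N -> a i ord0 l <= a j ord0 l <
    ((f i).2 ord0 l + 1)%:~R * side (f i).1.
  by move=> ij; rewrite [a i _ _]aE; apply: (fM _ _ ij _ (dyadic_cube_corner _ _)).
have aub i l : ubound [set a j ord0 l | j in setT]
    (((f i).2 ord0 l + 1)%:~R * side (f i).1).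
  move=> _ [j _ <-]; apply: ltW; have [ij|/ltnW ji] := leqP i j.
    by have /andP[] := acube i j l ij.
  have /andP[ai _] := acube j i l ji; apply: le_lt_trans ai _.
  by have /andP[] := acube i i l (leqnn _).
exists (\row_l sup [set a j ord0 l | j in setT]) => i l.
have y1 : a i ord0 l <= sup [set a j ord0 l | j in setT].
  by apply: ub_le_sup; [exists (((f 0%N).2 ord0 l + 1)%:~R * side (f 0%N).1)|exists i].
have y2 : sup [set a j ord0 l | j in setT] <= ((f i).2 ord0 l + 1)%:~R * side (f i).1.
  by apply: ge_sup; [exists (a 0%N ord0 l), 0%N|exact: aub].
rewrite !mxE; move: y1; rewrite aE leNgt -dfloor_lt_int => y1.
have : dfloor (f i).1 (sup [set a j ord0 l | j in setT]) < (f i).2 ord0 l + 1 + 1.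
  rewrite dfloor_lt_int; apply: le_lt_trans y2 _.
  by rewrite ltr_pM2r ?side_gt0// ltr_int ltzD1.
lia.
Qed.

(** A state is an index j with a good cube. Both j and the level grow strictly, and the [nbr] of the
    next cube lies in the current one, which puts the limit point in every cube and in infinitely
    many U_j. *)
Lemma good_meets_limsup (q : nat -> I) (n0 : int) k0 :
  0 <= n0 -> cube n0 k0 `<=` @unit_cube R d -> (tail_mass t q 0 setT < +oo)%E ->
  good t q (n0, k0) -> exists y, [/\ cube n0 k0 y, lim_sup_set U (pi y) &
    forall i, ~ ocube (q i) y].
Proof.
move=> n00 p01 qfin gp.
pose inv (s : nat * (int * 'rV[int]_d)) :=
  [/\ 0 <= s.2.1, cube s.2.1 s.2.2 `<=` @unit_cube R d & good t q s.2].
pose rel (s s' : nat * (int * 'rV[int]_d)) := inv s -> [/\ inv s', (s.1 < s'.1)%N,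
  s.2.1 < s'.2.1 & nbr s'.2.1 s'.2.2 `<=` cube s.2.1 s.2.2 `&` pi @^-1` U s'.1].
have nexts s : {s' | rel s s'}.
  apply: cid; have [is_|nis] := pselect (inv s); last by exists s.
  case: s is_ => j [n k] [/= n_0 n01 gn].
  have [j' [n' [k' [jj nn gn' sub]]]] := good_step j.+1 n_0 n01 qfin gn.
  exists (j', (n', k')) => _; split => //; split => //=.
    exact: le_trans n_0 (ltW nn).
  by apply: subset_trans n01 => y /sub_nbr /sub[].
have [f [f0 fS]] := dependent_choice nexts (0%N, (n0, k0)).
have finv i : inv (f i).
  elim: i => [|i IH]; first by rewrite f0.
  by have [] := fS i IH.
have fsub i := fS i (finv i).
have [y yf] : exists y, forall i, nbr (f i).2.1 (f i).2.2 y.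
  apply: (nested_cubes_point (f := fun i => (f i).2)) => i z zi.
  by have [_ _ _ /(_ _ (sub_nbr zi))[]] := fsub i.
have yc i : cube (f i).2.1 (f i).2.2 y.
  by have [_ _ _ /(_ _ (yf i.+1))[]] := fsub i.
have fi i : (i <= (f i).1)%N /\ i%:Z <= (f i).2.1.
  elim: i => [|i [IH1 IH2]]; first by rewrite f0.
  have [_ h1 h2 _] := fsub i; split; first exact: leq_ltn_trans h1.
  by move: IH2 h2; lia.
exists y; split.
- by have := yc 0%N; rewrite f0.
- move=> n _; exists (f n.+1).1; first exact: (leq_trans (leqnSn _) (fi n.+1).1).
  by have [_ _ _ /(_ _ (yf n.+1))[]] := fsub n.
- move=> i qy; case qi : (q i) qy => [[m l]|]//= qy.
  (* After |m| steps the level is at least m, so a cover cube of level m containing y would contain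
     a good cube. *)
  have [_ _ [_ nb]] := finv (absz m); apply: (nb i); rewrite qi /=.
  have mf : m <= (f (absz m)).2.1 by have [_] := fi (absz m); lia.
  by split => //; exact: dyadic_cube_sub mf qy (yc _).
Qed.

End limsup.

(** * Dyadic content *)

Section contents.
Context {R : realType} {d : nat}.
Local Notation I := (option (int * 'rV[int]_d)).
Implicit Types (y z : 'rV[R]_d) (k : 'rV[int]_d) (t : R).
Local Notation pi := (@torus_pi R d).
Local Notation lam := (@lebesgue_row R d).
Local Notation cube := (@dyadic_cube R d).
Local Notation ocube := (@ocube R d).

(* Translation of cubes by an integer vector; it is a translation of cubes only
   at nonnegative levels, where the side is an integral fraction of 1. *)
Definition shift_index (n : int) (v k : 'rV[int]_d) : 'rV[int]_d :=
  \row_i (k ord0 i + v ord0 i * 2 ^+ absz n).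

Lemma idx_shift (n : int) v z : 0 <= n ->
  idx n (z + map_mx intr v) = shift_index n v (idx n z).
Proof.
by case: n => // n _; apply/rowP => i; rewrite !mxE dfloor_shift.
Qed.

Lemma shift_index_inj n v : injective (shift_index n v).
Proof. by move=> k l /rowP kl; apply/rowP => i; have := kl i; rewrite !mxE !ord1 => /addIr. Qed.

Lemma cube_shift (n : int) v k z : 0 <= n ->
  cube n (shift_index n v k) (z + map_mx intr v) <-> cube n k z.
Proof.
move=> n0; rewrite !dyadic_cubeE /= idx_shift//.
by split=> [/shift_index_inj|->].
Qed.

Lemma corner_shift (n : int) v k : 0 <= n ->
  corner n (shift_index n v k) = corner n k + map_mx intr v :> 'rV[R]_d.
Proof.
case: n => // n _; apply/rowP => i; rewrite !mxE /= intrD mulrDl; congr (_ + _).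
by rewrite intrM rmorphXn /= /side -invr_expz -exprnP -mulrA mulfV ?mulr1 ?gt_eqF ?exprn_gt0//.
Qed.

(** Cubes of negative level have no dyadic integer translate in general and are dropped. Such a cube
    cannot meet a good cube of nonnegative level, which it would contain. *)
Definition shift_cover (v : 'rV[int]_d) (o : I) : I :=
  if o is Some (m, l) then if 0 <= m then Some (m, shift_index m v l) else None
  else None.

(** The property of the limsup set from which the content bound is derived. It concerns the unit
    cube; other cubes are reached by integer translation in [cover_sum_ge]. *)
Definition meets_good_cubes (t : R) (E : set (torus R d)) := forall (q : nat -> I) (n : int) k,
  0 <= n -> cube n k `<=` @unit_cube R d -> (tail_mass t q 0 setT < +oo)%E ->
  good t q (n, k) -> exists y, [/\ cube n k y, E (pi y) & forall i, ~ ocube (q i) y].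

Lemma good_shift t q (n : int) z v : 0 <= n -> good t q (n, idx n z) ->
  good t (fun i => shift_cover v (q i)) (n, idx n (z + map_mx intr v)).
Proof.
move=> n0 [/= qn nb]; split => /=.
  apply: le_lt_trans qn; rewrite !tail_massE; apply: lee_nneseries => // i _.
  rewrite !corner_massE /shift_cover; case: (q i) => [[m l]|]; last by rewrite !mul0e.
  case: ifPn => m0; last by rewrite mul0e mule_ge0// lee_fin powR_ge0.
  rewrite /= corner_shift// !diracE idx_shift//.
  rewrite (_ : (_ + _ \in _) = (corner m l \in cube n (idx n z)))//.
  by apply/idP/idP; rewrite !inE => /(cube_shift _ _ _ n0).
move=> i; have := nb i; rewrite /shift_cover; case: (q i) => [[m l]|]//.
case: ifPn => m0 nbi // -[mn sub]; apply: nbi; split => // y yz.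
apply/(cube_shift v _ _ m0)/sub.
by rewrite idx_shift//; apply/(cube_shift _ _ _ n0).
Qed.

Lemma tail_massT_shift t q v :
  (tail_mass t (fun i => shift_cover v (q i)) 0 setT <= tail_mass t q 0 (@setT 'rV[R]_d))%E.
Proof.
rewrite !tail_massT; apply: lee_nneseries => [i _ _|i _]; rewrite lee_fin ?cube_weight_ge0//.
rewrite /shift_cover; case: (q i) => [[m l]|]//; case: ifPn => //= _; exact: powR_ge0.
Qed.

(** A cover with too small a sum makes the cube good: a single cover cube containing it would
    already weigh side_n^t. *)
Lemma cover_sum_ge t E (q : nat -> I) (n : int) k : 0 < t -> t <= d%:R ->
  meets_good_cubes t E -> cube n k `&` pi @^-1` E `<=` \bigcup_i ocube (q i) ->
  ((side n `^ t)%:E <= \sum_(i <oo) (cube_weight t (q i))%:E)%E.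
Proof.
move=> t0 td ME cov; rewrite leNgt; apply/negP => qn.
have qfin : (tail_mass t q 0 (@setT 'rV[R]_d) < +oo)%E.
  by rewrite tail_massT; apply: lt_trans qn _; exact: ltry.
have gp : good t q (n, k).
  split => /=.
    apply: le_lt_trans qn; rewrite -tail_massT; apply: le_measure; rewrite ?inE//.
    exact: measurable_cube.
  move=> i; case qi : (q i) => [[m l]|]//= [mn _].
  move: qn; apply/negP; rewrite -leNgt -tail_massT.
  apply: (@le_trans _ _ (cube_weight t (q i))%:E); last exact: tail_mass_ge.
  by rewrite qi lee_fin /= ge0_ler_powR ?nnegrE ?(ltW (side_gt0 _)) ?(ltW t0) ?le_side.
(* The given cube may be larger than the unit cube; a good subcube of nonnegative level can be
   translated into it. *)
have [z [n' [zk nz nn' gz]]] : exists z n', [/\ cube n k z,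
    forall i, ~ ocube (q i) z, n <= n'%:Z & good t q (n'%:Z, idx n' z)].
  apply: contrapT => H; have := good_not_covered td gp.
  rewrite (measure_negligible _ _) ?ltxx//.
    apply: measurableD; first exact: measurable_cube.
    by apply: bigcupT_measurable => i; exact: measurable_ocube.
  apply: (negligible_not_good td qfin) => [i z [_ nz] qz|z [kz nz]].
    by apply: nz; exists i.
  exists (absz n) => n' nn' gz; apply: H; exists z, n'; split => //; last lia.
  by move=> i qz; apply: nz; exists i.
have zsub : cube n' (idx n' z) `<=` cube n k.
  exact: dyadic_cube_sub nn' zk (dyadic_cube_idx _ _).
pose v : 'rV[int]_d := \row_i - Num.floor (z ord0 i).
have zv : @unit_cube R d (z + map_mx intr v).
  by move=> i; rewrite !mxE; have := floor_itv (z ord0 i); rewrite intrD mulrNz; lra.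
have [y [yc Ey ny]] := ME _ _ _ (le0z_nat n') (unit_cube_sub (le0z_nat n') zv)
  (le_lt_trans (tail_massT_shift t q v) qfin) (good_shift v (le0z_nat n') gz).
pose y' := y - map_mx intr v.
have y'y : y' + map_mx intr v = y by rewrite /y' subrK.
have y'c : cube n' (idx n' z) y'.
  by apply/(cube_shift v _ _ (le0z_nat n')); rewrite y'y -idx_shift.
have [i _] : (\bigcup_i ocube (q i)) y'.
  by apply: cov; split; [exact: zsub|rewrite /= -(torus_pi_shift _ v) y'y].
case: gz => _ /(_ i); have := ny i; rewrite /shift_cover.
case: (q i) => [[m l]|]// nyi nb qy'; move: nyi; case: ifPn => m0.
  by apply; rewrite /= -y'y; apply/cube_shift.
(* A dropped cube has negative level and would contain the good cube it meets. *)
move=> _; have mn' : m <= n' by lia.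
by apply: nb; split => //; exact: dyadic_cube_sub mn' qy' y'c.
Qed.

Hypothesis d_gt0 : (0 < d)%N.

Lemma diameter_cube (n : int) k :
  diameter euclid_dist (cube n k) = (Num.sqrt d%:R * side n)%:E.
Proof.
have sd : 0 < Num.sqrt d%:R :> R by rewrite sqrtr_gt0 ltr0n.
have s0 : 0 < side n :> R := side_gt0 n.
apply/eqP; rewrite eq_le; apply/andP; split.
  apply: ge_ereal_sup => _ [->|[x xk [y yk <-]]].
    by rewrite lee_fin mulr_ge0// ltW.
  by rewrite lee_fin; exact: cube_euclid_dist xk yk.
(* The diagonal is not attained in a half-open cube, so it is approached through factors r < 1. *)
apply/lee_mul01Pr; first by rewrite lee_fin mulr_ge0// ltW.
move=> r /andP[r0 r1]; apply: ereal_sup_ubound; right.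
exists (corner n k + const_mx (r * side n)).
  move=> i; rewrite !mxE intrD mulrDl mul1r lerDl ltrD2l.
  by rewrite mulr_ge0 ?ltW//= gtr_pMl.
exists (corner n k); first exact: dyadic_cube_corner.
rewrite /euclid_dist addrC addKr /euclid_norm -EFinM; congr EFin.
under eq_bigr do rewrite mxE.
rewrite sumr_const card_ord -[_ *+ _]mulr_natl sqrtrM ?ler0n// sqrtr_sqr.
by rewrite ger0_norm ?mulr_ge0 ?ltW// mulrCA.
Qed.

Lemma side_inj : injective (@side R).
Proof.
move=> n m /(ieexprIz (ltr0n _ 2)) h; apply: oppr_inj; apply: h.
by rewrite gt_eqF// ltr1n.
Qed.

(** The level is read off the diameter. This turns sums over a set of cubes into sums over codes. *)
Lemma cube_inj (n m : int) k l : cube n k = cube m l -> (n, k) = (m, l).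
Proof.
move=> nm; have := diameter_cube n k; rewrite nm diameter_cube => -[].
move=> /mulfI h; have nm' : m = n.
  by apply: side_inj; apply: h; rewrite gt_eqF// sqrtr_gt0 ltr0n.
move: nm; rewrite nm' => nm; have : cube n l (corner n k).
  by rewrite -nm; exact: dyadic_cube_corner.
by rewrite dyadic_cubeE /= idx_corner => ->.
Qed.

Lemma diameter_ocube t (n : int) k :
  (diameter euclid_dist (cube n k) `^ t = (Num.sqrt d%:R `^ t)%:E * (side n `^ t)%:E)%E.
Proof.
by rewrite diameter_cube poweR_EFin -EFinM powRM// ltW// side_gt0.
Qed.

Lemma dyadic_content_ge t E (D : set 'rV[R]_d) : 0 < t -> t <= d%:R ->
  meets_good_cubes t E -> dyadic_cubes D ->
  (diameter euclid_dist D `^ t <= dyadic_content t (pi @^-1` E `&` D))%E.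
Proof.
move=> t0 td ME [n [k ->]]; apply: le_ereal_inf_tmp => _ [C [Cc Cd cov] <-].
(* Each cube of C receives exactly one index, so the series over q is the sum over C. *)
pose q (m : nat) : I := if enum_cube m is Some (n, k) then
  if `[< C (cube n k) >] then Some (n, k) else None else None.
have qC m n' k' : q m = Some (n', k') -> C (cube n' k') /\ m = pickle (n', k').
  rewrite /q /enum_cube; have := @pickle_invK (int * 'rV[int]_d)%type m.
  case: pickle_inv => //= -[a b] pm; case: asboolP => // Cab [<- <-].
  by split; rewrite ?pm.
have Cq n' k' : C (cube n' k') -> exists m, q m = Some (n', k').
  by move=> Cn; exists (pickle (n', k')); rewrite /q /enum_cube pickleK_inv; case: asboolP.
have qcov : cube n k `&` pi @^-1` E `<=` \bigcup_i ocube (q i).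
  move=> x [kx Ex]; have [D1 CD Dx] := cov _ (conj Ex kx).
  have [n' [k' DE]] := Cd _ CD; have Cn : C (cube n' k') by rewrite -DE.
  by have [j qj] := Cq _ _ Cn; exists j => //; rewrite qj /= -DE.
have := cover_sum_ge t0 td ME qcov => h.
rewrite diameter_ocube.
apply: (le_trans (lee_wpmul2l _ h)); first by rewrite lee_fin powR_ge0.
pose P : pred nat := fun m => isSome (q m).
have Pinj : set_inj P (fun m => ocube (q m)).
  move=> i j; rewrite !inE /P.
  case qi : (q i) => [[a b]|]// _; case qj : (q j) => [[a' b']|]//= _ ab.
  have [_ ->] := qC _ _ _ qi; have [_ ->] := qC _ _ _ qj.
  by rewrite (cube_inj ab).
have -> : C = [set ocube (q m) | m in P].
  apply/seteqP; split=> [D1 CD|_ [m Pm <-]].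
    have [n' [k' DE]] := Cd _ CD; have Cn : C (cube n' k') by rewrite -DE.
    by have [j qj] := Cq _ _ Cn; exists j; rewrite /P qj//= -DE.
  move: Pm; rewrite /P; case qm : (q m) => [[a b]|]// _.
  by have [] := qC _ _ _ qm.
rewrite esum_pred_image//; last by move=> m _; exact: poweR_ge0.
rewrite -nneseriesZl; last by move=> i _; rewrite lee_fin cube_weight_ge0.
rewrite [leRHS]eseries_mkcond; apply: lee_nneseries.
  by move=> i _ _; rewrite mule_ge0// lee_fin ?powR_ge0 ?cube_weight_ge0.
move=> i _; rewrite /P; case: (q i) => [[a b]|] /=; last by rewrite mule0.
by rewrite diameter_ocube.
Qed.

(** An indexed family may repeat cubes while content sums over a set; choosing one index per cube
    can only lower the sum. *)
Lemma dyadic_content_le_esum (J : pointedType) (P : set J) (p : J -> int * 'rV[int]_d)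
    (t : R) (S : set 'rV[R]_d) :
  countable P -> S `<=` \bigcup_(j in P) cube (p j).1 (p j).2 ->
  (dyadic_content t S <=
   \esum_(j in P) (diameter euclid_dist (cube (p j).1 (p j).2) `^ t))%E.
Proof.
move=> cP cov.
pose C := [set cube (p j).1 (p j).2 | j in P].
have : (dyadic_content t S <= \esum_(D in C) (diameter euclid_dist D `^ t))%E.
  apply: ereal_inf_lbound; exists C => //; split.
  - exact: sub_countable (card_image_le _ _) cP.
  - by move=> _ [j _ <-]; exists (p j).1, (p j).2.
  - by move=> x /cov[j Pj xj]; exists (cube (p j).1 (p j).2) => //; exists j.
move=> /le_trans; apply.
have /choice[g gC] : forall D, exists j, C D -> P j /\ cube (p j).1 (p j).2 = D.
  move=> D; have [[j Pj jD]|nD] := pselect (C D); first by exists j.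
  by exists point => /nD.
have ginj : set_inj C g.
  move=> D D'; rewrite !inE => CD CD' gg.
  by rewrite -(gC _ CD).2 -(gC _ CD').2 gg.
have -> : (\esum_(D in C) (diameter euclid_dist D `^ t) =
   \esum_(j in g @` C) (diameter euclid_dist (cube (p j).1 (p j).2) `^ t))%E.
  by rewrite [RHS]esum_image//; apply: eq_esum => D /gC[_ ->].
apply: le_ereal_sup => _ [X [finX XC] <-]; exists X => //; split => //.
by apply: subset_trans XC _ => _ [D /gC[Pg _] <-].
Qed.

End contents.

(** * Hausdorff dimension *)

Section hausdorff.
Context {R : realType} {d : nat}.
Implicit Types (y z : 'rV[R]_d) (k : 'rV[int]_d) (t : R).
Local Notation pi := (@torus_pi R d).
Local Notation cube := (@dyadic_cube R d).
Local Notation digits := {ffun 'I_d -> 'I_3}.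

(** The first digits choose an integer translation in {-1, 0, 1}^d, to account for wrapping around
    the torus; the second choose a neighbouring cube. *)
Definition cover_index (n : int) k (e : digits * digits) : 'rV[int]_d :=
  nbr_index (shift_index n (\row_i ((e.1 i)%:Z - 1)) k) e.2.

Lemma small_set_cover t (A : set (torus R d)) (eta : R) : 0 < t -> 0 < eta ->
  (diameter (@torus_dist R d) A <= (8^-1)%:E)%E ->
  exists (n : nat) k,
    (forall y, unit_cube y -> A (pi y) -> exists e, cube n (cover_index n k e) y) /\
    ((side n `^ t)%:E <=
     (4 `^ t)%:E * (diameter (@torus_dist R d) A `^ t + eta%:E))%E.
Proof.
move=> t0 eta0 A8.
have A0 : (0 <= diameter (@torus_dist R d) A)%E by apply: ereal_sup_ubound; left.
have fA : diameter (@torus_dist R d) A \is a fin_num.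
  by rewrite ge0_fin_numE//; apply: le_lt_trans A8 _; exact: ltry.
move: A8 A0; rewrite -(fineK fA); set delta := fine _; rewrite !lee_fin => d8 d0.
(* A positive substitute for the diameter, which may vanish; it costs at most [eta] in the t-th
   power. *)
pose rho := Num.max delta (Num.min (8^-1) (eta `^ t^-1)).
have rho0 : 0 < rho by rewrite lt_max lt_min powR_gt0// invr_gt0 ltr0n orbT.
have rho8 : rho <= 8^-1 by rewrite ge_max d8 ge_min lexx.
have drho : delta <= rho by rewrite le_max lexx.
have rhot : rho `^ t <= delta `^ t + eta.
  have [dm|md] := leP delta (Num.min (8^-1) (eta `^ t^-1)); last first.
    by rewrite /rho max_l ?(ltW md)// lerDl ltW.
  rewrite /rho max_r// -[leLHS]add0r lerD ?powR_ge0//.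
  apply: (@le_trans _ _ ((eta `^ t^-1) `^ t)).
    rewrite ge0_ler_powR ?nnegrE ?powR_ge0 ?(ltW t0)//.
      by rewrite le_min powR_ge0 invr_ge0 ler0n.
    by rewrite ge_min lexx orbT.
  by rewrite -powRrM mulVf ?gt_eqF// powRr1// ltW.
have r20 : 0 < 2 * rho by lra.
have r21 : 2 * rho < 1 by lra.
(* 2 rho <= side n < 4 rho: the lower bound exceeds the diameter, the upper one is the source of
   4^t. *)
have [n /andP[nr rn]] := exists_side_bracket r20 r21.
have bound : ((side n `^ t)%:E <= (4 `^ t)%:E * (delta%:E `^ t + eta%:E))%E.
  rewrite poweR_EFin -EFinD -EFinM lee_fin.
  apply: (@le_trans _ _ ((4 * rho) `^ t)).
    rewrite ge0_ler_powR ?nnegrE ?(ltW t0) ?(ltW (side_gt0 _))//; lra.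
  by rewrite powRM ?(ltW rho0)// ler_wpM2l ?powR_ge0.
have [[a0 Aa0]|nA] := pselect (A !=set0); last first.
  exists n, 0; split => // y _ Ay; exfalso; apply: nA; by exists (pi y).
have [a ax a01] := torus_lift_unit a0.
exists n, (idx n a); split => // y y01 Ay.
have : torus_dist (pi a) (pi y) < side n.
  rewrite ax; apply: (@le_lt_trans _ _ delta); last lra.
  by rewrite -lee_fin fineK//; apply: ereal_sup_ubound; right; exists a0 => //; exists (pi y).
move=> /torus_dist_lift[b /eqP/torus_piP[m bym] ab].
have n1 : side n <= 1 :> R by exact: side_le1.
(* Both a and y lie in the unit cube and b is within 1 of a, so the integer coordinates of b - y are
   below 2 in absolute value. *)
have mi i : `|m ord0 i| <= 1.
  have abi := le_lt_trans (euclid_dist_ge_coord a b i) ab.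
  move/rowP: bym => /(_ i); rewrite !mxE ord1 => bymi.
  have := a01 i; have := y01 i; move: abi; rewrite ltr_norml => abi yi ai.
  have m2 : m ord0 i < 2.
    by rewrite -(ltr_int R) ord1 -bymi; move: abi yi ai; rewrite !ord1; lra.
  have m2' : - m ord0 i < 2.
    by rewrite -(ltr_int R) mulrNz ord1 -bymi; move: abi yi ai; rewrite !ord1; lra.
  by move: m2 m2'; rewrite !ord1; clear; lia.
have bn : nbr n (idx n a) b.
  apply: (box_sub_nbr (e := side n)) => // i; rewrite distrC.
  exact: le_lt_trans (euclid_dist_ge_coord a b i) ab.
have f3 i : (absz (1 - m ord0 i)%R < 3)%N by move: (mi i); clear; lia.
pose e1 : digits := [ffun i => Ordinal (f3 i)].
have e1E : \row_i ((e1 i)%:Z - 1) = - m.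
  by apply/rowP => i; rewrite !mxE ffunE /= !ord1; move: (mi i); rewrite !ord1; clear; lia.
suff : nbr n (shift_index n (- m) (idx n a)) y.
  by rewrite nbr_bigcup => -[e2 _ ye2]; exists (e1, e2); rewrite /cover_index /= e1E.
have yb : y = b + map_mx intr (- m).
  by rewrite map_mxN -bym opprB addrCA subrr addr0.
move=> i; rewrite yb idx_shift// !mxE; have := bn i; rewrite !mxE.
by rewrite opprD addrACA subrr addr0.
Qed.

Hypothesis d_gt0 : (0 < d)%N.

(** One [eps] bounds the sum of the diameters to the power t, the other is the total of the errors
    eps / 2^(i+1) allowed for sets of tiny diameter. *)
Lemma hausdorff_measure0_content t (E : set (torus R d)) (eps : R) : 0 < t ->
  hausdorff_measure (@torus_dist R d) t E = 0%E -> 0 < eps ->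
  (dyadic_content t (pi @^-1` E `&` @unit_cube R d) <=
   (Num.sqrt d%:R `^ t * #|{: digits * digits}|%:R * 4 `^ t * (eps + eps))%:E)%E.
Proof.
move=> t0 H0 eps0.
have [A [EA A8] Aeps] : exists2 A : (set (torus R d))^nat,
    E `<=` \bigcup_i A i /\ (forall i, (diameter (@torus_dist R d) (A i) <= (8^-1)%:E)%E) &
    (\sum_(0 <= i <oo) (diameter (@torus_dist R d) (A i) `^ t) < eps%:E)%E.
  have : (hausdorff_premeasure (@torus_dist R d) t 8^-1 E < eps%:E)%E.
    apply: (@le_lt_trans _ _ 0%E); last by rewrite lte_fin.
    rewrite -H0; apply: ereal_sup_ubound; exists 8^-1 => //=.
  by move=> /ereal_inf_lt[_ [A hA <-] ?]; exists A.
have e2 (i : nat) : 0 < eps / (2 ^ i.+1)%:R by rewrite divr_gt0// ltr0n expn_gt0.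
have H i := small_set_cover t0 (e2 i) (A8 i).
have [n Hn] := choice H; have {H Hn}[l Hl] := choice Hn.
pose T : finType := (digits * digits)%type.
pose e0 : T := ([ffun=> ord0], [ffun=> ord0]).
pose p (j : nat * nat) : int * 'rV[int]_d :=
  ((n j.1)%:Z, cover_index (n j.1) (l j.1) (nth e0 (enum T) j.2)).
pose P : set (nat * nat) := [set: nat] `*`` (fun=> `I_#|T|).
have cov : pi @^-1` E `&` @unit_cube R d `<=` \bigcup_(j in P) cube (p j).1 (p j).2.
  move=> y [Ey y01]; have [i _ Ai] := EA _ Ey.
  have [/(_ y y01 Ai)[e ye] _] := Hl i.
  exists (i, index e (enum T)); last by rewrite /p /= nth_index ?mem_enum.
  by split => //=; rewrite cardE index_mem mem_enum.
apply: (le_trans (@dyadic_content_le_esum _ _ (nat * nat)%type P p t _ _ cov)).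
  exact: countableP.
under eq_esum => j Pj do rewrite diameter_ocube //.
rewrite /P -(esum_esum (a := fun i j => (Num.sqrt d%:R `^ t)%:E * (side (n i) `^ t)%:E)%E);
  last by move=> i j _ _; rewrite mule_ge0// lee_fin powR_ge0.
pose c := Num.sqrt d%:R `^ t * #|T|%:R.
have c0 : 0 <= c by rewrite mulr_ge0// powR_ge0.
have inner i : (\esum_(j in `I_#|T|) ((Num.sqrt d%:R `^ t)%:E * (side (n i) `^ t)%:E) =
    c%:E * (side (n i) `^ t)%:E)%E.
  rewrite esum_fset; last 2 first.
  - exact: finite_II.
  - by move=> j _; rewrite mule_ge0// lee_fin powR_ge0.
  rewrite -(fsbig_ord _ _ (fun=> ((Num.sqrt d%:R `^ t)%:E * (side (n i) `^ t)%:E)%E)).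
  rewrite -EFinM sumEFin sumr_const card_ord -EFinM; congr EFin.
  by rewrite -[LHS]mulr_natr /c mulrAC.
rewrite (_ : esum _ _ = \esum_(i in setT) (c%:E * (side (n i) `^ t)%:E))%E;
  last by apply: eq_esum => i _; exact: inner.
rewrite -nneseries_esumT; last by move=> i; rewrite mule_ge0// lee_fin powR_ge0.
rewrite nneseriesZl; last by move=> i _; rewrite lee_fin powR_ge0.
rewrite -/c -[c * _ * _]mulrA [leRHS]EFinM lee_wpmul2l ?lee_fin//.
apply: (@le_trans _ _ (\sum_(i <oo) (4 `^ t)%:E *
    (diameter (@torus_dist R d) (A i) `^ t + (eps / (2 ^ i.+1)%:R)%:E))%E).
  apply: lee_nneseries => [i _ _|i _]; first by rewrite lee_fin powR_ge0.
  by case: (Hl i).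
rewrite nneseriesZl; last first.
  by move=> i _; rewrite adde_ge0 ?poweR_ge0// lee_fin ltW.
rewrite EFinM lee_wpmul2l ?lee_fin ?powR_ge0//.
apply: le_trans (epsilon_trick xpredT _ (ltW eps0)) _.
  by move=> i; exact: poweR_ge0.
by rewrite EFinD leeD2r// ltW.
Qed.

Lemma hausdorff_dim_ge (s : R) (E : set (torus R d)) :
  torus_large_intersection s E -> (s%:E <= hausdorff_dim (@torus_dist R d) E)%E.
Proof.
move=> [_ LE]; apply: le_ereal_inf_tmp => _ [t [t0 H0] <-].
rewrite lee_fin leNgt; apply/negP => ts.
have D0 : dyadic_cubes (@unit_cube R d) by exists 0, 0; exact: unit_cubeE.
have := LE _ t D0; rewrite t0 ts => /(_ isT).
rewrite unit_cubeE diameter_ocube// -unit_cubeE.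
set g := Num.sqrt _ `^ _; set N := #|{: digits * digits}|%:R : R.
have g0 : 0 < g by rewrite powR_gt0// sqrtr_gt0 ltr0n.
have N0 : 0 < N by rewrite ltr0n; apply/card_gt0P; exists ([ffun=> ord0], [ffun=> ord0]).
have f0 : 0 < 4 `^ t :> R by rewrite powR_gt0.
(* With this epsilon the upper bound for the content is half of the lower bound [g]. *)
have e0 : 0 < (4 * N * 4 `^ t)^-1 by rewrite invr_gt0 !mulr_gt0.
move=> /le_trans/(_ (hausdorff_measure0_content t0 H0 e0)).
rewrite -EFinM lee_fin -/g -/N /side oppr0 expr0z powR1 mulr1.
have -> : g * N * 4 `^ t * ((4 * N * 4 `^ t)^-1 + (4 * N * 4 `^ t)^-1) = g / 2.
  by field; rewrite !gt_eqF.
lra.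
Qed.

End hausdorff.

(** * The limsup set and exponents below s *)

Lemma preimage_limsup_Gdelta {R : realType} {d : nat} (U : nat -> set (torus R d)) :
  (forall j, open (U j)) -> Gdelta (torus_pi @^-1` lim_sup_set U).
Proof.
move=> oU; exists (fun n => torus_pi @^-1` (\bigcup_(j in [set j | (n <= j)%N]) U j)).
  move=> n; rewrite preimage_bigcup; apply: bigcup_open => j _; exact: oU.
by rewrite /lim_sup_set preimage_bigcap.
Qed.

Lemma energy_bound_of_ratio {R : realType} {d : nat} (t : R) (x : nat -> torus R d)
    (r : nat -> R) (U : nat -> set (torus R d)) :
  (forall j, U j !=set0) -> (forall j, open (U j)) ->
  (ereal_sup [set riesz_energy t (U j) *
     torus_lebesgue (torus_ball (x j) (r j)) /
     torus_lebesgue (U j) ^+ 2 | j in [set: nat]] < +oo)%E ->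
  exists2 C, 0 < C & forall j, energy_bound t C (x j) (r j) (U j).
Proof.
move=> U0 oU; set S := ereal_sup _ => Soo.
(* The maximum with 1 makes the constant positive. *)
exists (Num.max 1 (fine S)); first by rewrite lt_max ltr01.
move=> j; rewrite /energy_bound.
have mU : measurable (U j) by apply/measurable_torusE; exact: measurable_lift.
have u0 := torus_lebesgue_open_gt0 (oU j) (U0 j).
have fU := torus_lebesgue_fin mU.
have := @ereal_sup_ubound R [set riesz_energy t (U j) *
     torus_lebesgue (torus_ball (x j) (r j)) /
     torus_lebesgue (U j) ^+ 2 | j in [set: nat]]%E _ (ex_intro2 _ _ j Logic.I erefl).
rewrite -/S -(fineK fU) -EFin_expe => jS.
have u20 : 0 < fine (torus_lebesgue (U j)) ^+ 2.
  by rewrite exprn_gt0// fine_gt0// u0 -ge0_fin_numE.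
move: jS; rewrite inver gt_eqF// lee_pdivrMr// => /le_trans; apply.
rewrite lee_wpmul2r//; first by rewrite lee_fin ltW.
case: S Soo => [a| |]//= _; last exact: leNye.
by rewrite lee_fin le_max lexx orbT.
Qed.

Theorem theorem3p1 (R : realType) (d : nat) (hd : (1 <= d)%N)
    (x : nat -> torus R d) (r : nat -> R) (U : nat -> set (torus R d))
    (r_gt0 : forall j, 0 < r j) (r_cvg0 : r @ \oo --> (0 : R))
    (U_neq0 : forall j, U j !=set0) (U_open : forall j, open (U j))
    (U_sub : forall j, U j `<=` torus_ball (x j) (r j))
    (E_full : torus_lebesgue
                (~` lim_sup_set (fun j => torus_ball (x j) (r j))) = 0%E) :
  let s : R := sup [set t : R | 0 < t < d%:R /\
    (ereal_sup [set riesz_energy t (U j) *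
                    torus_lebesgue (torus_ball (x j) (r j)) /
                    torus_lebesgue (U j) ^+ 2 | j in [set: nat]] < +oo)%E] in
  (s%:E <= hausdorff_dim (@torus_dist R d) (lim_sup_set U))%E /\
  torus_large_intersection s (lim_sup_set U).
Proof.
set S := [set t | _]; move=> s.
suff LE : torus_large_intersection s (lim_sup_set U) by split => //; exact: hausdorff_dim_ge.
split; first exact: preimage_limsup_Gdelta.
move=> D t hD /andP[t0 ts].
(* The supremum of the empty set is 0, which 0 < t < s excludes. *)
have S0 : S !=set0.
  by apply/set0P/eqP => S0; move: ts; rewrite /s S0 sup0 ltNge ltW.
have [tt [/andP[_ ttd] ratio] ttt] := sup_gt S0 ts.
have [C C0 bound] := energy_bound_of_ratio U_neq0 U_open ratio.
have td : t <= d%:R by apply/ltW/(lt_trans ttt).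
apply: dyadic_content_ge => // q n k n0 kn qfin gq.
exact: (good_meets_limsup hd t0 (ltW ttt) td C0 r_gt0 r_cvg0 U_neq0 U_open U_sub E_full
  bound n0 kn qfin gq).
Qed.
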